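(* Let $K_5-45$ be the graph obtained from the complete graph $K_5$ on the vertex set $\{1,2,3,4,5\}$ by deleting the edge $45$. For any continuous almost embedding $g\colon K_5-45\to\mathbb{R}^2$ we have $$l(g):=w_g(123,4)-w_g(123,5)=\pm 1,$$ i.e. this integer is equal to $1$ or to $-1$.
   Context: A graph is identified with its body (geometric realization as a 1-dimensional complex); $ij$ denotes the edge joining vertices $i$ and $j$, regarded as a closed segment in the body. Two edges are non-adjacent if they have no common vertex. A continuous map $g\colon K_5-45\to\mathbb{R}^2$ is an almost embedding if the $g$-images of any two non-adjacent edges are disjoint. $123$ denotes the oriented cycle $(1,2,3)$ in the graph. For a continuous map $g$ of a graph to $\mathbb{R}^2$, an oriented cycle $C$ in the graph and a vertex $v$ with $g(v)\notin g(C)$, set $w_g(C,v):=w(g|_C,g(v))$, the winding number of the closed curve $g|_C$ around the point $g(v)$. (For an almost embedding $g$ of $K_5-45$ the points $g(4),g(5)$ do not lie on $g(123)$.) *)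

(* Defs.v *)
From HB Require Import structures.
From mathcomp Require Import all_boot all_order all_algebra.
From mathcomp Require Import all_classical all_reals all_analysis.

Set Implicit Arguments.
Unset Strict Implicit.
Unset Printing Implicit Defensive.

Import Order.TTheory GRing.Theory Num.Theory.
Import numFieldNormedType.Exports.

Local Open Scope classical_set_scope.
Local Open Scope ring_scope.

(* The body of a graph on 'I_n sits in R^n, with vertex i at the i-th vector
   of the standard basis. *)
Definition vertex_pt (R : realType) (n : nat) (i : 'I_n) : 'rV[R]_n :=
  delta_mx 0 i.

Definition edge_pt (R : realType) (n : nat) (i j : 'I_n) (t : R) : 'rV[R]_n :=
  (1 - t) *: vertex_pt R i + t *: vertex_pt R j.

Definition edge_body (R : realType) (n : nat) (i j : 'I_n) : set 'rV[R]_n :=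
  edge_pt i j @` `[0, 1].

Definition body (R : realType) (n : nat) (e : rel 'I_n) : set 'rV[R]_n :=
  [set x | (exists i, x = vertex_pt R i) \/
           (exists i j, e i j /\ edge_body i j x)].

Definition nonadjacent (n : nat) (i j k l : 'I_n) : bool :=
  [&& i != k, i != l, j != k & j != l].

(* The values of g outside the body of e are irrelevant. *)
Definition almost_embedding (R : realType) (n : nat) (e : rel 'I_n)
    (g : 'rV[R]_n -> R * R) : Prop :=
  {within body e, continuous g} /\
  forall i j k l, e i j -> e k l -> nonadjacent i j k l ->
    (g @` edge_body i j) `&` (g @` edge_body k l) = set0.

(* Walk through x and then the vertices of s, one unit of time per edge. *)
Fixpoint walk_pt (R : realType) (n : nat) (x : 'I_n) (s : seq 'I_n) (t : R) :
    'rV[R]_n :=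
  match s with
  | [::] => vertex_pt R x
  | y :: s' => if t <= 1 then edge_pt x y t else walk_pt y s' (t - 1)
  end.

(* The oriented cycle (x, s_0, s_1, ...) back to x, parametrized by
   [0, (size s).+1]. *)
Definition cycle_pt (R : realType) (n : nat) (x : 'I_n) (s : seq 'I_n) :
    R -> 'rV[R]_n :=
  walk_pt x (rcons s x).

(* theta is a continuous choice of polar angle of c around p on [a, b]. *)
Definition angle_lift (R : realType) (a b : R) (c : R -> R * R) (p : R * R)
    (theta : R -> R) : Prop :=
  {within `[a, b], continuous theta} /\
  forall t, t \in `[a, b] -> exists r : R,
    [/\ 0 < r, (c t).1 - p.1 = r * cos (theta t)
             & (c t).2 - p.2 = r * sin (theta t)].

(* Winding number around p of the closed curve c on [a, b]. Meaningful when c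
   is continuous with c a = c b and avoids p: the increment of theta is then
   an integer multiple of 2 pi that does not depend on theta. *)
Definition winding_number (R : realType) (a b : R) (c : R -> R * R)
    (p : R * R) : int :=
  xget 0 [set m : int | exists2 theta : R -> R, angle_lift a b c p theta
                        & theta b - theta a = 2 * pi * m%:~R].

Definition graph_winding (R : realType) (n : nat) (g : 'rV[R]_n -> R * R)
    (x : 'I_n) (s : seq 'I_n) (v : 'I_n) : int :=
  winding_number 0 (size s).+1%:R (g \o cycle_pt x s) (g (vertex_pt R v)).

Definition v1 : 'I_5 := @Ordinal 5 0 isT.
Definition v2 : 'I_5 := @Ordinal 5 1 isT.
Definition v3 : 'I_5 := @Ordinal 5 2 isT.
Definition v4 : 'I_5 := @Ordinal 5 3 isT.
Definition v5 : 'I_5 := @Ordinal 5 4 isT.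

Definition K5_minus_45 : rel 'I_5 := fun i j =>
  [&& i != j, (i, j) != (v4, v5) & (i, j) != (v5, v4)].

(* Main.v *)
Require Import Defs.
From HB Require Import structures.
From mathcomp Require Import all_boot all_order all_algebra.
From mathcomp Require Import all_classical all_reals all_analysis.
From mathcomp Require Import lra ring zify.

Set Implicit Arguments.
Unset Strict Implicit.
Unset Printing Implicit Defensive.

Import Order.TTheory GRing.Theory Num.Theory.
Import numFieldNormedType.Exports.

Local Open Scope classical_set_scope.
Local Open Scope ring_scope.

(** Write p = g(4) and q = g(5).  The height |z-p| / (|z-p| + |z-q|) and the
    direction of (z-p) / (z-q) are coordinates that turn the plane without p
    and q into an open annulus, with p at the bottom and q at the top
    ([bipolar_inj]).  The direction at g(t) is the difference of the polar
    angles around p and around q, so its lift along the triangle 123 increases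
    by 2 pi l, where l is the difference of the two winding numbers.  In the
    universal cover, a periodic strip, the theorem becomes a statement on
    disjoint curves: for each corner x_i of the triangle there is an arm A_i from the bottom to x_i and an arm B_i from
    x_i to the top; A_i misses all translates of B_j for i <> j, and the side
    opposite to x_i misses all translates of A_i and B_i.  Going round the
    triangle leads from x_1 to its l-th translate.

    Only finitely many pairs of compact curves have to be kept apart, so a fine
    grid replaces the curves by lattice walks with the same properties
    ([discretize]); the rest is combinatorics in a strip of Z x Z
    ([strip_theorem]).

    For a face f of the grid let w_i(f) be the signed number of times that the
    line M_i, that is A_i followed by B_i, rises to the left of f.  Three facts
    carry the proof.
    - [duality]: w_i(x_j) + w_j(x_i) = 1, also after a translation of x_j and its
      arms.  Exchanging the two walks on the boundary of the rectangle of pairs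
      of points turns one number into the other ([rectangle]).
    - [aligned]: w_i takes the same value at the two ends of the side opposite
      to x_i, since that side misses M_i.
    - [star]: if that side runs from x_j to the s-th translate of x_m, then w_j
      is at most 0 at the translates s-1, s-2, and so on, of x_m.  Erasing
      loops from M_i gives a simple line N that also misses the side.  Take the
      last translate of N to the left of x_j.  The translate of N that lies k
      periods further has x_j + k on its right but x_j on its left, and so also
      x_m + s, the other end of the side.  Detour that translate of N through
      x_j + k, along the arms of x_j + k: the detour stays on the right
      ([frontier]), so the new line passes to the right of x_m + s.  Exchanging
      its ends for the full arms of x_j + k does not change the count at
      x_m + s, because the arms of x_m + s lead to the bottom and to the top
      without meeting the exchanged pieces ([swap_low], [swap_high]).

    If l >= 2, then [star] at two sides contradicts [duality] ([no_big]);
    reversing the triangle excludes l <= -2.  If l = 0, then by [aligned] each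
    w_i has a single value at the two other corners, and by [duality] these
    three integers add up to 1 in pairs, which is impossible modulo 2. *)

(** * Walks on the square lattice *)

Definition pt : Type := (int * int)%type.
Notation cell i j := (@pair int int i j).
Definition adj (u v : pt) : bool :=
  ((u.1 == v.1) && ((v.2 == u.2 + 1) || (u.2 == v.2 + 1))) ||
  ((u.2 == v.2) && ((v.1 == u.1 + 1) || (u.1 == v.1 + 1))).

(** A point f also stands for the unit face whose lower left corner it is.  The
    crossing number counts a step with its sign when the step meets the ray that
    runs from the centre of the face f to the left. *)
Definition crossing (f u v : pt) : int :=
  if u.1 <= f.1 then (f.2 < v.2)%R%:Z - (f.2 < u.2)%R%:Z else 0.

Fixpoint wind (f : pt) (P : seq pt) : int :=
  match P with
  | u :: ((v :: _) as P') => crossing f u v + wind f P'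
  | _ => 0
  end.

Definition steps (P : seq pt) : seq (pt * pt) := zip P (behead P).
Definition unused (a b : pt) (P : seq pt) : bool :=
  ((a, b) \notin steps P) && ((b, a) \notin steps P).

Definition walk (x y : pt) (P : seq pt) : bool :=
  [&& P != [::], head x P == x, last x P == y & sorted adj P].

Lemma adjC u v : adj u v = adj v u.
Proof. rewrite /adj; apply/idP/idP; lia. Qed.

Lemma stepsP P a b : ((a, b) \in steps P) -> (a \in P) * (b \in P).
Proof.
rewrite /steps; elim: P => // u [|v P] //= IH; rewrite inE.
case/orP => [/eqP[-> ->]|/IH[h1 h2]]; first by rewrite !inE !eqxx orbT.
by rewrite [a \in _]in_cons [b \in _]in_cons h1 h2 !orbT.
Qed.

Lemma unusedl a b P : a \notin P -> unused a b P.
Proof. by move=> h; rewrite /unused; apply/andP; split; apply: contra h => /stepsP[]. Qed.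
Lemma unusedr a b P : b \notin P -> unused a b P.
Proof. by move=> h; rewrite /unused; apply/andP; split; apply: contra h => /stepsP[]. Qed.
Lemma unusedC a b P : unused a b P = unused b a P.
Proof. by rewrite /unused andbC. Qed.

Lemma unused_cons a b u v P : unused a b [:: u, v & P] =
  [&& (a, b) != (u, v), (b, a) != (u, v) & unused a b (v :: P)].
Proof.
rewrite /unused /= !inE !negb_or.
by rewrite [RHS]andbA [RHS]andbACA.
Qed.

Lemma wind_cons f u v P : wind f [:: u, v & P] = crossing f u v + wind f (v :: P).
Proof. by []. Qed.

Lemma sorted_cons u v P : sorted adj [:: u, v & P] = adj u v && sorted adj (v :: P).
Proof. by []. Qed.

Lemma wind_cat f P y Q : wind f (P ++ y :: Q) = wind f (rcons P y) + wind f (y :: Q).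
Proof.
elim: P => [|u [|v P] IH] /=; first by rewrite add0r.
- by rewrite addr0.
- by rewrite -addrA; congr (_ + _); rewrite -IH.
Qed.

(** Two horizontal neighbours are separated by one grid edge, and only steps
    along that edge meet one of the two rays without meeting the other. *)
Lemma wind_right (i j : int) P : sorted adj P -> unused (cell (i + 1) j) (cell (i + 1) (j + 1)) P ->
  wind (cell (i + 1) j) P = wind (cell i j) P.
Proof.
elim: P => // -[u1 u2] [|[v1 v2] P] // IH; rewrite unused_cons !wind_cons sorted_cons => /andP[h hP].
rewrite !xpair_eqE => /and3P[n1 n2 nP]; rewrite IH //; congr (_ + _).
rewrite /crossing /adj /= in h n1 n2 *; case: ifP; case: ifP; lia.
Qed.

(** Contribution of an end u of a walk when the ray moves across row j: the walk
    enters or leaves the band swept by the ray at u. *)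
Definition corner (i j : int) (u : pt) : int := ((u.1 <= i)%R && (u.2 == j))%:Z.

(** Moving the ray down across row j + 1 changes the count only where the walk
    enters or leaves the part of that row on the left of the edge that separates
    the faces; steps within the row do not count, so only the two ends of the
    walk remain. *)
Lemma wind_up (i j : int) x y P : walk x y P -> unused (cell i (j + 1)) (cell (i + 1) (j + 1)) P ->
  wind (cell i j) P - wind (cell i (j + 1)) P = corner i (j + 1) y - corner i (j + 1) x.
Proof.
rewrite /walk => /and4P[P0 /eqP hx /eqP hy].
elim: P x P0 hx hy => // u [|v P] IH x _; first by move=> /= -> ->; rewrite !subrr.
rewrite !wind_cons sorted_cons -[head _ _]/u -[last x _]/(last v P) => <- hy /andP[h hP]; rewrite unused_cons => /and3P[n1 n2 nP].
have {}IH := IH v isT erefl hy hP nP.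
suff : crossing (cell i j) u v - crossing (cell i (j + 1)) u v = corner i (j + 1) v - corner i (j + 1) u by lia.
move: u v h n1 n2 {IH nP hP hy} => -[u1 u2] [v1 v2]; rewrite !xpair_eqE /crossing /adj /corner /=.
case: ifP; lia.
Qed.

Lemma walk_rev x y P : walk x y P = walk y x (rev P).
Proof.
have aux a b Q : walk a b Q -> walk b a (rev Q).
  rewrite /walk => /and4P[Q0 /eqP ha /eqP hb hs]; rewrite rev_sorted.
  rewrite (eq_sorted (e' := adj)) ?hs; last by move=> ? ?; rewrite adjC.
  case: Q Q0 ha hb {hs} => // u Q _ /= -> <-.
  rewrite andbT rev_cons; case: (lastP Q) => [|Q' v]; first by rewrite /= eqxx.
  by rewrite rev_rcons rcons_cons /= !last_rcons !eqxx.
by apply/idP/idP; [exact: aux | rewrite -{2}[P]revK; exact: aux].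
Qed.

Lemma walk_mem x y P : walk x y P -> (x \in P) && (y \in P).
Proof.
case/and4P; case: P => // u P _ /eqP /= -> /eqP <- _.
by rewrite mem_head mem_last.
Qed.

Lemma walk_cat x y z P Q : walk x y (rcons P y) -> walk y z (y :: Q) ->
  walk x z (P ++ y :: Q).
Proof.
rewrite /walk => /and4P[_ /eqP hx _ sP] /and4P[_ _ /eqP hz sQ].
rewrite last_cat /= in hz *; apply/and4P; split.
- by case: P {hx sP}.
- by case: P hx {sP} => [|u P] /= ->.
- by rewrite hz.
case: P hx sP => [|u P] //= hx.
by rewrite rcons_path cat_path /= => /andP[-> ->].
Qed.

Lemma walk_split x y P z Q : walk x y (P ++ z :: Q) -> walk x z (rcons P z) /\ walk z y (z :: Q).
Proof.
rewrite /walk => /and4P[_ hx hy hs]; split; apply/and4P; split => //.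
all: try by [case: (P) | case: (P) hx | rewrite last_rcons | rewrite /= eqxx].
- by move: hs; rewrite -cat_rcons => /cat_sorted2[].
- by move: hy; rewrite last_cat.
- by move/cat_sorted2: hs => [].
Qed.

Lemma wind_far_left (f : pt) P : {in P, forall u : pt, f.1 < u.1} -> wind f P = 0.
Proof.
elim: P => // u [|v P] IH // h; rewrite wind_cons IH ?addr0; last first.
  by move=> w hw; apply: h; rewrite in_cons hw orbT.
by rewrite /crossing leNgt h ?mem_head.
Qed.

Lemma wind_far_right (f x y : pt) P : {in P, forall u : pt, u.1 <= f.1} -> walk x y P ->
  wind f P = (f.2 < y.2)%R%:Z - (f.2 < x.2)%R%:Z.
Proof.
move=> h /and4P[P0 /eqP hx /eqP hy _].
elim: P x P0 h hx hy => // u [|v P] IH x _ h; first by move=> /= -> ->; rewrite subrr.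
rewrite wind_cons -[head _ _]/u -[last x _]/(last v P) => <- hy.
have {}IH := IH v isT _ erefl hy; rewrite IH; last first.
  by move=> w hw; apply: h; rewrite in_cons hw orbT.
by rewrite /crossing h ?mem_head //=; lia.
Qed.

Lemma wind_below (f : pt) P : {in P, forall u : pt, f.2 < u.2} -> wind f P = 0.
Proof.
elim: P => // u [|v P] IH // h; rewrite wind_cons IH ?addr0; last first.
  by move=> w hw; apply: h; rewrite in_cons hw orbT.
by rewrite /crossing !h ?in_cons ?eqxx ?orbT //; case: ifP.
Qed.

Lemma wind_above (f : pt) P : {in P, forall u : pt, u.2 <= f.2} -> wind f P = 0.
Proof.
elim: P => // u [|v P] IH // h; rewrite wind_cons IH ?addr0; last first.
  by move=> w hw; apply: h; rewrite in_cons hw orbT.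
by rewrite /crossing !ltNge !h ?in_cons ?eqxx ?orbT //; case: ifP.
Qed.

Definition sh (c : int) (u : pt) : pt := cell (u.1 + c) u.2.

Lemma shK c : cancel (sh c) (sh (- c)).
Proof. by case=> a b; rewrite /sh /= addrK. Qed.
Lemma shNK c : cancel (sh (- c)) (sh c).
Proof. by case=> a b; rewrite /sh /= subrK. Qed.
Lemma sh_add c d u : sh c (sh d u) = sh (c + d) u.
Proof. by rewrite /sh /=; congr pair; lia. Qed.
Lemma sh0 u : sh 0 u = u.
Proof. by case: u => a b; rewrite /sh addr0. Qed.

Lemma mem_sh c u P : (u \in map (sh c) P) = (sh (- c) u \in P).
Proof. by rewrite -{1}(shNK c u) (mem_map (can_inj (shK c))). Qed.

Lemma wind_sh c f P : wind f (map (sh c) P) = wind (sh (- c) f) P.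
Proof.
elim: P => // u [|v P] IH //; rewrite wind_cons -IH.
rewrite [LHS]wind_cons; congr (_ + _).
by rewrite /crossing /=; congr (if _ then _ else _); lia.
Qed.

Lemma adj_sh c u v : adj (sh c u) (sh c v) = adj u v.
Proof. rewrite /adj /=; apply/idP/idP; lia. Qed.

Lemma walk_sh c x y P : walk x y P -> walk (sh c x) (sh c y) (map (sh c) P).
Proof.
rewrite /walk => /and4P[P0 /eqP hx /eqP hy hs]; apply/and4P; split.
- by case: (P) P0.
- by case: (P) P0 hx => // u Q _ /= ->.
- by rewrite last_map hy.
- by rewrite sorted_map (eq_sorted (e' := adj)) // => u v /=; rewrite adj_sh.
Qed.

(** * Exchanging two disjoint walks *)

(** The number of times Q passes on the left of u, now with the ray at u shifted
    by half a unit so that it avoids the vertices of Q, and with a correction for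
    the rows of the two ends of Q that makes [rectangle1] an identity. *)
Definition coside (Q : seq pt) (q0 q1 u : pt) : int :=
  wind (cell (u.1 - 1) (u.2 - 1)) Q - (u.2 <= q1.2)%R%:Z + (u.2 <= q0.2)%R%:Z.

(** One step against one step: as the pair of ends runs around the square
    (u,u') x (v,v') it never becomes equal, and the vector between them does not
    wind around 0. *)
Lemma square_law u u' v v' : adj u u' -> adj v v' ->
  u != v -> u' != v -> u != v' -> u' != v' ->
  crossing v' u u' - crossing v u u' =
  crossing (cell (u'.1 - 1) (u'.2 - 1)) v v' - (u'.2 <= v'.2)%R%:Z + (u'.2 <= v.2)%R%:Z
  - (crossing (cell (u.1 - 1) (u.2 - 1)) v v' - (u.2 <= v'.2)%R%:Z + (u.2 <= v.2)%R%:Z).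
Proof.
move: u u' v v' => -[a b] [a' b'] [c d] [c' d']; rewrite /adj !xpair_eqE /crossing /=.
case/orP => /andP[/eqP <- /orP[]/eqP->]; case/orP => /andP[/eqP <- /orP[]/eqP->].
all: do ! (case: ifP => ?); lia.
Qed.

Lemma rectangle1 u u' q0 q1 Q : adj u u' -> walk q0 q1 Q -> u \notin Q -> u' \notin Q ->
  crossing q1 u u' - crossing q0 u u' = coside Q q0 q1 u' - coside Q q0 q1 u.
Proof.
move=> huu' /and4P[Q0 /eqP hx /eqP hy hs] hu hu'.
elim: Q q0 Q0 hx hy hs hu hu' => // v [|v' Q] IH q0 _.
  by move=> /= -> <- _; rewrite /coside /=; lia.
rewrite sorted_cons -[head _ _]/v -[last q0 _]/(last v' Q) => <- hy /andP[hv hs].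
rewrite !(in_cons, negb_or) => /andP[n1 n1'] /andP[n2 n2'].
have := IH v' isT erefl hy hs; rewrite !(in_cons, negb_or) => /(_ n1' n2').
move: n1' n2' => /andP[n3 _] /andP[n4 _].
rewrite /coside !wind_cons.
suff : crossing v' u u' - crossing v u u' =
  crossing (cell (u'.1 - 1) (u'.2 - 1)) v v' - (u'.2 <= v'.2)%R%:Z + (u'.2 <= v.2)%R%:Z
  - (crossing (cell (u.1 - 1) (u.2 - 1)) v v' - (u.2 <= v'.2)%R%:Z + (u.2 <= v.2)%R%:Z) by lia.
exact: square_law.
Qed.

(** Discrete form of the fact that two disjoint paths map the rectangle of pairs
    of parameters to the plane without 0, so that the vector from a point of Q to
    a point of P does not wind around 0 on the boundary of the rectangle.  The
    two sides of the equation are the contributions of the edges where P moves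
    and where Q moves. *)
Lemma rectangle p0 p1 P q0 q1 Q : walk p0 p1 P -> walk q0 q1 Q ->
  {in P, forall u : pt, u \notin Q} ->
  wind q1 P - wind q0 P = coside Q q0 q1 p1 - coside Q q0 q1 p0.
Proof.
move=> /and4P[P0 /eqP hx /eqP hy hs] hQ hPQ.
elim: P p0 P0 hx hy hs hPQ => // u [|v P] IH p0 _.
  by move=> /= -> -> _ _; rewrite !subrr.
rewrite sorted_cons -[head _ _]/u -[last p0 _]/(last v P) => <- hy /andP[hv hs] hPQ.
have hPQ' : {in v :: P, forall u : pt, u \notin Q}.
  by move=> w hw; apply: hPQ; rewrite in_cons hw orbT.
have := IH v isT erefl hy hs hPQ'.
have := @rectangle1 u v _ _ _ hv hQ (hPQ u _) (hPQ v _).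
rewrite !wind_cons !in_cons !eqxx !orbT => /(_ isT isT); lia.
Qed.

(** A function of faces that changes only across used edges is constant along any
    walk that avoids the used vertices. *)
Lemma walk_const (D : pt -> int) (ok : pt -> bool) x y Q :
  (forall i j : int, ok (cell (i + 1) j) -> D (cell (i + 1) j) = D (cell i j)) ->
  (forall i j : int, ok (cell i j) -> ok (cell i (j + 1)) -> D (cell i j) = D (cell i (j + 1))) ->
  walk x y Q -> {in Q, forall u : pt, ok u} -> D x = D y.
Proof.
move=> HR HU /and4P[Q0 /eqP hx /eqP hy hs].
elim: Q x Q0 hx hy hs => // u [|v Q] IH x _; first by move=> /= -> ->.
rewrite sorted_cons -[head _ _]/u -[last x _]/(last v Q) => <- hy /andP[hv hs] hok.
rewrite -(IH v isT erefl hy hs) => [|w hw]; last by apply: hok; rewrite in_cons hw orbT.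
have := hok u (mem_head _ _); have : ok v by apply: hok; rewrite !in_cons eqxx orbT.
move: u v hv {hy hs hok IH} => -[a b] [c d]; rewrite /adj /=.
case/orP => /andP[/eqP -> /orP[]/eqP ->] h1 h2.
- exact: HU.
- by rewrite -HU.
- by rewrite HR.
- exact: HR.
Qed.

(** * Arms in a horizontal strip *)

Definition W (A B : seq pt) (f : pt) : int := wind f A + wind f B.

(** Only the first vertex of a lower arm is on row 0, and only the last vertex of
    an upper arm is on row H; the counting lemmas depend on this. *)
Definition low (H : int) (x : pt) (A : seq pt) : Prop :=
  exists b, [/\ walk b x A, b.2 = 0, 0 < x.2 &
    {in behead A, forall u : pt, 0 < u.2 < H}].

Definition high (H : int) (x : pt) (B : seq pt) : Prop :=
  exists t, [/\ walk x t B, t.2 = H, x.2 < H &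
    {in behead (rev B), forall u : pt, 0 < u.2 < H}].

Lemma low_rows (H : int) x A : low H x A ->
  exists b, [/\ walk b x A, b.2 = 0, 0 < x.2 &
    {in A, forall u : pt, (0 <= u.2 < H) /\ (u.2 = 0 -> u = b)}].
Proof.
case=> b [wA b0 x0 hA]; exists b; split => //.
case/and4P: wA; case: A hA => // b' A /= hA _ /eqP-> /eqP ex _.
have xA : x \in A.
  by move: (mem_last b A); rewrite ex inE => /orP[/eqP e|//]; move: x0; rewrite e; lia.
move=> u; rewrite inE => /orP[/eqP->|/hA uA]; last by split; lia.
by have := hA x xA; rewrite b0; split => //; lia.
Qed.

Lemma high_rows (H : int) x B : high H x B ->
  exists t, [/\ walk x t B, t.2 = H, x.2 < H &
    {in B, forall u : pt, (0 < u.2 <= H) /\ (u.2 = H -> u = t)}].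
Proof.
case=> t [wB tH xH hB]; exists t; split => //.
move: (wB); rewrite walk_rev => /and4P[+ + +  _] u.
rewrite -mem_rev; move: (rev B) hB => {wB B}[|t' B] //= hB _ /eqP-> /eqP ex.
have xB : x \in B.
  by move: (mem_last t B); rewrite ex inE => /orP[/eqP e|//]; move: xH; rewrite e; lia.
rewrite inE => /orP[/eqP->|/hB uB]; last by split; lia.
by have := hB x xB; rewrite tH; split => //; lia.
Qed.

Definition disjoint (P Q : seq pt) : Prop := {in P, forall u : pt, u \notin Q}.

Lemma disjoint_sym P Q : disjoint P Q -> disjoint Q P.
Proof. by move=> h u uQ; apply/negP => uP; move: (h u uP); rewrite uQ. Qed.

(** The ends of the line are on the rows 0 and H, so inside the strip the count
    changes only across the line itself. *)
Lemma W_mid (H : int) x A B y z C : low H x A -> high H x B -> walk y z C ->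
  {in C, forall u : pt, 0 < u.2 < H} -> disjoint C A -> disjoint C B ->
  W A B y = W A B z.
Proof.
move=> /low_rows[b [wA b0 x0 hA]] /high_rows[t [wB tH xH hB]] wC hC CA CB.
pose ok u := [&& u \notin A, u \notin B & 0 < u.2 < H].
apply: (@walk_const _ ok _ _ _ _ _ wC) => [i j|i j|u uC].
- case/and3P => nA nB _; rewrite /W.
  case/and4P: wA => _ _ _ sA; case/and4P: wB => _ _ _ sB.
  by rewrite !wind_right //; exact: unusedl.
- case/and3P => _ _ /= hj /and3P[nA nB /= hj1]; rewrite /W.
  have := wind_up wA (unusedl (cell (i + 1) (j + 1)) nA).
  have := wind_up wB (unusedl (cell (i + 1) (j + 1)) nB).
  rewrite /corner b0 tH; lia.
- by rewrite /ok CA // CB // hC.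
Qed.

(** Along a way to the top that misses A and A', the difference of the two counts
    is constant: the contributions of their common end x cancel.  At its
    end on row H both counts vanish. *)
Lemma swap_low (H : int) x A A' z Q : low H x A -> low H x A' -> high H z Q ->
  disjoint Q A -> disjoint Q A' -> wind z A = wind z A'.
Proof.
move=> /low_rows[b [wA b0 x0 hA]] /low_rows[b' [wA' b0' _ hA']] /high_rows[t [wQ tH zH hQ]] QA QA'.
pose ok u := [&& u \notin A, u \notin A' & 0 < u.2].
pose D f := wind f A - wind f A'.
suff : D z = D t.
{ rewrite /D [wind t A]wind_above ?[wind t A']wind_above; first lia.
  all: move=> u; first [move=> /hA[+ _] | move=> /hA'[+ _]]. all: lia. }
apply: (@walk_const _ ok _ _ _ _ _ wQ) => [i j|i j|u uC].
- case/and3P => nA nB _; rewrite /D.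
  case/and4P: wA => _ _ _ sA; case/and4P: wA' => _ _ _ sB.
  by rewrite !wind_right //; exact: unusedl.
- case/and3P => _ _ /= hj /and3P[nA nB /= hj1]; rewrite /D.
  have := wind_up wA (unusedl (cell (i + 1) (j + 1)) nA).
  have := wind_up wA' (unusedl (cell (i + 1) (j + 1)) nB).
  rewrite /corner b0 b0'; lia.
- by rewrite /ok QA // QA' //; case: (hQ u uC) => /andP[->].
Qed.

Lemma swap_high (H : int) x B B' z Q : high H x B -> high H x B' -> low H z Q ->
  disjoint Q B -> disjoint Q B' -> wind z B = wind z B'.
Proof.
move=> /high_rows[t [wB tH xH hB]] /high_rows[t' [wB' tH' _ hB']] /low_rows[b [wQ b0 z0 hQ]] QB QB'.
pose ok u := [&& u \notin B, u \notin B' & u.2 < H].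
pose D f := wind f B - wind f B'.
suff : D b = D z.
{ rewrite /D [wind b B]wind_below ?[wind b B']wind_below; first lia.
  all: by move=> u; first [move=> /hB[+ _] | move=> /hB'[+ _]]; lia. }
apply: (@walk_const _ ok _ _ _ _ _ wQ) => [i j|i j|u uC].
- case/and3P => nA nB _; rewrite /D.
  case/and4P: wB => _ _ _ sA; case/and4P: wB' => _ _ _ sB.
  by rewrite !wind_right //; exact: unusedl.
- case/and3P => _ _ /= hj /and3P[nA nB /= hj1]; rewrite /D.
  have := wind_up wB (unusedl (cell (i + 1) (j + 1)) nA).
  have := wind_up wB' (unusedl (cell (i + 1) (j + 1)) nB).
  rewrite /corner tH tH'; lia.
- by rewrite /ok QB // QB' //; case: (hQ u uC) => /andP[_ ->].
Qed.

(** Apply [rectangle] to A against B' and to B against A'.  The ends of the four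
    arms on the rows 0 and H contribute constants, and x may be compared with the
    face on its lower left because A' and B' do not pass through x. *)
Lemma duality (H : int) x A B x' A' B' : low H x A -> high H x B -> low H x' A' -> high H x' B' ->
  disjoint A B' -> disjoint B A' -> W A B x' + W A' B' x = 1.
Proof.
move=> /low_rows[b [wA b0 x0 hA]] /high_rows[t [wB tH xH hB]] /low_rows[b' [wA' b0' x0' hA']] /high_rows[t' [wB' tH' xH' hB']] dAB dBA.
have xA' : x \notin A' by apply: dBA; case/andP: (walk_mem wB).
have xB' : x \notin B' by apply: dAB; case/andP: (walk_mem wA).
(* [coside] looks at the face on the lower left of its vertex. *)
have sw : W A' B' x = W A' B' (cell (x.1 - 1) (x.2 - 1)).
  case: x {wA wB hA hB} x0 xH xA' xB' => i j /= x0 xH xA' xB'.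
  have /= r1 := @wind_right (i - 1) j A'; have /= r2 := @wind_right (i - 1) j B'.
  have /= u1 := @wind_up (i - 1) (j - 1) _ _ _ wA'.
  have /= u2 := @wind_up (i - 1) (j - 1) _ _ _ wB'.
  move: r1 r2 u1 u2; rewrite /W !subrK.
  move=> -> //; [|by case/and4P: wA'|exact: unusedl].
  move=> -> //; [|by case/and4P: wB'|exact: unusedl].
  rewrite /corner b0' tH' => /(_ (unusedr _ xA')) + /(_ (unusedr _ xB')); lia.
have r1 := rectangle wA wB' dAB; have r2 := rectangle wB wA' dBA.
have e1 : wind t' A = 0 by apply: wind_above => u /hA[+ _]; lia.
have e2 : wind b' B = 0 by apply: wind_below => u /hB[+ _]; lia.
have e3 k : wind (cell k (b.2 - 1)) B' = 0 by apply: wind_below => u /hB'[+ _] /=; lia.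
have e4 k : wind (cell k (t.2 - 1)) A' = 0 by apply: wind_above => u /hA'[+ _] /=; lia.
by rewrite sw; move: r1 r2; rewrite /W /coside e1 e2 e3 e4; lia.
Qed.

(** * The region between two lines *)

Definition line (H : int) (n m : pt) (N : seq pt) : Prop :=
  [/\ walk n m N, n.2 = 0, m.2 = H &
   {in N, forall u : pt, [/\ 0 <= u.2 <= H, u.2 = 0 -> u = n & u.2 = H -> u = m]}].

(** The vertex w is one of the four corners of the face f. *)
Definition touch (f w : pt) : bool :=
  ((f.1 == w.1) || (f.1 == w.1 - 1)) && ((f.2 == w.2) || (f.2 == w.2 - 1)).

Lemma line_up (H : int) n m N (i j : int) : line H n m N -> 0 < j + 1 < H ->
  unused (cell i (j + 1)) (cell (i + 1) (j + 1)) N -> wind (cell i j) N = wind (cell i (j + 1)) N.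
Proof. by move=> [w n0 mH _] hj /(wind_up w); rewrite /corner n0 mH; lia. Qed.

Lemma line_row0 (H : int) n m N (i : int) : 0 < H -> line H n m N -> wind (cell i 0) N = (n.1 <= i)%R%:Z.
Proof.
move=> H0 [w n0 mH hN].
have un : unused (cell i (-1 + 1)) (cell (i + 1) (-1 + 1)) N.
  rewrite addNr; case: (boolP ((cell i 0) \in N)) => [h|]; last exact: unusedl.
  apply: unusedr; apply/negP => h'.
  have [_ /(_ erefl) e _] := hN _ h; have [_ /(_ erefl) e' _] := hN _ h'.
  by move: e'; rewrite -e => -[]; lia.
have e : wind (cell i (-1)) N = 0 by apply: wind_below => u /hN[+ _ _] /=; lia.
have := wind_up w un; rewrite e -[-1 + 1]/(0 : int) /corner n0 mH; lia.
Qed.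

Lemma steps_index P a b : uniq P -> (a, b) \in steps P -> index b P = (index a P).+1.
Proof.
elim: P => // u [|v P] IH // /andP[uP vP]; rewrite -[steps _]/((u, v) :: steps (v :: P)) in_cons.
case/orP => [/eqP[-> ->]|h].
  by move: uP; rewrite in_cons negb_or => /andP[/negbTE h _]; rewrite /= h !eqxx.
have [ha hb] := stepsP h.
have na : (u == a) = false by apply/negbTE; apply: contra uP => /eqP ->.
have nb : (u == b) = false by apply/negbTE; apply: contra uP => /eqP ->.
have e w : index w [:: u, v & P] = if u == w then 0%N else (index w (v :: P)).+1 by [].
by rewrite !e na nb IH.
Qed.

(** Steps raise the index by one, so besides its predecessor n' the vertex n is
    joined to nothing but its successor. *)
Lemma steps_nbr P1 n' n P2 w : uniq (P1 ++ n' :: n :: P2) -> w != n' ->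
  ~~ unused n w (P1 ++ n' :: n :: P2) ->
  w \in (P1 ++ n' :: n :: P2) /\ index w (P1 ++ n' :: n :: P2) = (size P1).+2.
Proof.
set N := _ ++ _ => uN wn'.
have [n1 n2] : n' \notin P1 /\ n \notin P1.
  move: uN; rewrite /N cat_uniq => /and3P[_ /hasPn h _].
  by split; apply: h; rewrite !inE eqxx ?orbT.
have nn' : n' != n.
  by move: uN; rewrite /N cat_uniq /= !inE !negb_or => /and3P[_ _ /andP[/andP[->]]].
have in' : index n' N = size P1 by rewrite /N index_cat (negbTE n1) /= eqxx addn0.
have inn : index n N = (size P1).+1.
  by rewrite /N index_cat (negbTE n2) /= (negbTE nn') eqxx addn1.
rewrite /unused negb_and !negbK => /orP[] h; have [h1 h2] := stepsP h; split => //.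
  by rewrite (steps_index uN h) inn.
have := steps_index uN h; rewrite inn => -[e].
by move: wn'; rewrite -(nth_index n' h1) -e -in' nth_index ?eqxx //; rewrite /N mem_cat inE eqxx orbT.
Qed.

Lemma steps_nbr_uniq P1 n' n P2 w w' : uniq (P1 ++ n' :: n :: P2) -> w != n' -> w' != n' ->
  w != w' -> unused n w (P1 ++ n' :: n :: P2) || unused n w' (P1 ++ n' :: n :: P2).
Proof.
move=> uN h h' ww'; rewrite -[X in X || _]negbK -[X in _ || X]negbK -negb_and.
apply/negP => /andP[/(steps_nbr uN h)[m e] /(steps_nbr uN h')[m' e']].
by move: ww'; rewrite -(nth_index n m) -(nth_index n m') e e' eqxx.
Qed.

Section Frontier.
Variables (H : int) (H0 : 0 < H) (n0 n1 m0 m1 : pt) (N M : seq pt).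
Hypotheses (lN : line H n0 n1 N) (uN : uniq N) (lM : line H m0 m1 M).
(** The vertex w lies strictly to the right of N. *)
Definition good (w : pt) : Prop :=
  w \notin N /\ (forall f, touch f w -> 0 <= f.2 < H -> 1 <= wind f N).
Hypothesis hM : forall a b, (a, b) \in steps M -> (a, b) \in steps N \/ good a \/ good b.
Hypothesis hm0 : m0 = n0 \/ good m0.

(** Faces on the left of N that M nevertheless leaves on its right.  The aim is
    that there are none. *)
Let E (f : pt) : bool := [&& 0 <= f.2 < H, wind f N <= 0 & 1 <= wind f M].

Lemma good_notE w f : good w -> touch f w -> E f = false.
Proof. by case=> _ h /h; rewrite /E; case: (boolP (0 <= f.2 < H)) => //= _ /(_ isT); lia. Qed.

(** An edge off N that M traverses has a good end, and no face touching a good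
    vertex is in E.  Hence E is constant across all edges off N. *)
Lemma E_edge a b f f' : unused a b N -> touch f a -> touch f b -> touch f' a -> touch f' b ->
  (unused a b M -> wind f M = wind f' M /\ wind f N = wind f' N) ->
  (0 <= f.2 < H) = (0 <= f'.2 < H) ->
  E f = E f'.
Proof.
move=> uab fa fb f'a f'b hun hr; case: (boolP (unused a b M)) => [/hun[e1 e2]|].
  by rewrite /E hr e1 e2.
have key : good a \/ good b -> E f = E f'.
  by case=> g; rewrite !(good_notE g).
case/andP: uab => u1 u2; rewrite /unused negb_and !negbK => /orP[] /hM[h|h].
- by rewrite h in u1.
- exact: key.
- by rewrite h in u2.
- by case: h => h; apply: key; [right|left].
Qed.

Lemma E_right (i j : int) : unused (cell (i + 1) j) (cell (i + 1) (j + 1)) N ->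
  E (cell (i + 1) j) = E (cell i j).
Proof.
move=> un; apply: (E_edge un); first [by [] | by rewrite /touch /=; lia | idtac].
move=> un'; case: lN => /and4P[_ _ _ sN] _ _ _; case: lM => /and4P[_ _ _ sM] _ _ _.
by rewrite !wind_right.
Qed.

Lemma E_up (i j : int) : 0 < j + 1 < H -> unused (cell i (j + 1)) (cell (i + 1) (j + 1)) N ->
  E (cell i j) = E (cell i (j + 1)).
Proof.
move=> hj un; apply: (E_edge un); first [by rewrite /touch /=; lia | idtac].
by move=> un'; rewrite (line_up lM) // (line_up lN).
Qed.

Lemma E_row0 (f : pt) : f.2 <= 0 -> E f = false.
Proof.
case: f => i j /= j0; rewrite /E /=; case: (boolP (0 <= j < H)) => //= hj.
have -> : j = 0 by lia.
rewrite (line_row0 _ H0 lN) (line_row0 _ H0 lM).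
case: hm0 => [->|[_ /(_ (cell m0.1 0))]]; first lia.
have tm : touch (cell m0.1 0) m0 by case: lM => _ m00 _ _; rewrite /touch m00 /= !eqxx.
by move/(_ tm); rewrite /= H0 (line_row0 _ H0 lN) => /(_ isT); lia.
Qed.

(** The four faces around a vertex n in cyclic order, from one side of the edge
    by which N enters n to the other.  At most one of the three remaining edges at
    n belongs to N, so each of the two faces in the middle is linked to one of the
    outer ones. *)
Let square_bool (u1 u2 u3 a b c d : bool) : u1 || u2 -> u1 || u3 -> u2 || u3 ->
  (u1 -> a = b) -> (u2 -> b = c) -> (u3 -> c = d) -> a = false -> d = false ->
  b = false /\ c = false.
Proof.
case: u1; case: u2; case: u3 => //= _ _ _ h1 h2 h3 ha hd;
  try (have {}h1 := h1 isT); try (have {}h2 := h2 isT); try (have {}h3 := h3 isT);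
  by split; congruence.
Qed.

(** Passing from n' to the next vertex n of N: the two faces beside the edge n'n
    also touch n', and the other two faces at n are reached from these without
    crossing N. *)
Lemma E_around_step N1 n' n N2 : N = N1 ++ n' :: n :: N2 ->
  (forall f, touch f n' -> E f = false) -> forall f, touch f n -> E f = false.
Proof.
move=> eN IH f fn; case: lN => wN n00 n1H hN.
have n'N : n' \in N by rewrite eN mem_cat inE eqxx orbT.
have nN : n \in N by rewrite eN mem_cat !inE eqxx !orbT.
have [rn zn tn] := hN n nN; have [rn' zn' tn'] := hN n' n'N.
have ad : adj n' n.
  by case/and4P: wN => _ _ _; rewrite eN => /cat_sorted2[_] /=; case/andP.
have nn' : n' != n.
  by move: uN; rewrite eN cat_uniq /= !inE !negb_or => /and3P[_ _ /andP[/andP[->]]].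
have [nz|nz] := eqVneq n.2 0.
  apply: E_row0; move: fn; rewrite /touch; lia.
have [nH|nH] := eqVneq n.2 H.
  have n'H : n'.2 != H.
    by apply: contra nn' => /eqP h; rewrite (tn nH) (tn' h).
  have [fH|fH] := eqVneq f.2 H; first by rewrite /E fH ltxx andbF.
  by apply: IH; move: fn ad fH n'H nH rn'; rewrite /touch /adj; lia.
have nb w w' : w != n' -> w' != n' -> w != w' -> unused n w N || unused n w' N.
  by rewrite eN => h1 h2 h3; apply: steps_nbr_uniq => //; rewrite -eN.
case: n nN rn zn tn ad nn' nz nH nb fn {eN} => a b nN /= rn zn tn ad nn' nz nH nb fn.
have hb : 0 < b < H by lia.
have hr : unused (cell a b) (cell (a + 1) b) N -> E (cell a (b - 1)) = E (cell a b).
  by have /= := @E_up a (b - 1); rewrite subrK; apply.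
have hl : unused (cell a b) (cell (a - 1) b) N -> E (cell (a - 1) (b - 1)) = E (cell (a - 1) b).
  by rewrite unusedC; have /= := @E_up (a - 1) (b - 1); rewrite !subrK; apply.
have hu : unused (cell a b) (cell a (b + 1)) N -> E (cell a b) = E (cell (a - 1) b).
  by have /= := @E_right (a - 1) b; rewrite !subrK; apply.
have hd : unused (cell a b) (cell a (b - 1)) N -> E (cell a (b - 1)) = E (cell (a - 1) (b - 1)).
  by rewrite unusedC; have /= := @E_right (a - 1) (b - 1); rewrite !subrK; apply.
have [K1 K2] : (E (cell a b) = false /\ E (cell (a - 1) b) = false) /\
   (E (cell a (b - 1)) = false /\ E (cell (a - 1) (b - 1)) = false).
  clear nz nH rn zn tn hb.
  case: n' IH n'N rn' zn' tn' ad nn' nb => c d IH _ _ _ _ ad _ nb.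
  have touches x y : touch (cell x y) (cell c d) -> E (cell x y) = false by exact: IH.
  have pr x y x' y' : ((x != c) || (y != d)) && ((x' != c) || (y' != d)) ->
     (x != x') || (y != y') -> unused (cell a b) (cell x y) N || unused (cell a b) (cell x' y') N.
    by move=> /andP[h1 h2] h3; apply: nb; rewrite xpair_eqE negb_and.
  move: ad; rewrite /adj /= => /orP[] /andP[/eqP h1 /orP[] /eqP h2].
  - have [] := @square_bool _ _ _ _ _ _ _ (pr (a + 1) b a (b + 1) _ _)
      (pr (a + 1) b (a - 1) b _ _) (pr a (b + 1) (a - 1) b _ _) hr hu (fun h => esym (hl h)) _ _;
      first [by clear -h1 h2; lia | by apply: touches; rewrite /touch /=; clear -h1 h2; lia | move=> -> ->].
    by rewrite !touches // /touch /=; clear -h1 h2; lia.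
  - have [] := @square_bool _ _ _ _ _ _ _ (pr (a + 1) b a (b - 1) _ _)
      (pr (a + 1) b (a - 1) b _ _) (pr a (b - 1) (a - 1) b _ _) (fun h => esym (hr h)) hd hl _ _;
      first [by clear -h1 h2; lia | by apply: touches; rewrite /touch /=; clear -h1 h2; lia | move=> -> ->].
    by rewrite !touches // /touch /=; clear -h1 h2; lia.
  - have [] := @square_bool _ _ _ _ _ _ _ (pr a (b + 1) (a + 1) b _ _)
      (pr a (b + 1) a (b - 1) _ _) (pr (a + 1) b a (b - 1) _ _) (fun h => esym (hu h)) (fun h => esym (hr h)) hd _ _;
      first [by clear -h1 h2; lia | by apply: touches; rewrite /touch /=; clear -h1 h2; lia | move=> -> ->].
    by rewrite !touches // /touch /=; clear -h1 h2; lia.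
  - have [] := @square_bool _ _ _ _ _ _ _ (pr a (b + 1) (a - 1) b _ _)
      (pr a (b + 1) a (b - 1) _ _) (pr (a - 1) b a (b - 1) _ _) hu (fun h => esym (hl h)) (fun h => esym (hd h)) _ _;
      first [by clear -h1 h2; lia | by apply: touches; rewrite /touch /=; clear -h1 h2; lia | move=> -> ->].
    by rewrite !touches // /touch /=; clear -h1 h2; lia.
move: fn; rewrite /touch; case: f => x y /= /andP[/orP[]/eqP-> /orP[]/eqP->].
all: by case: K1; case: K2.
Qed.

Lemma E_around n f : n \in N -> touch f n -> E f = false.
Proof.
suff key N1 : forall n N2, N = N1 ++ n :: N2 -> forall f, touch f n -> E f = false.
  by move=> nN; case/splitPr: nN (key) => N1 N2 k; exact: (k N1 n N2).
elim/last_ind: N1 => [|N1 n' IH] {f}n N2 eN f fn.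
  case: lN => /and4P[_ hn _ _] n00 _ _; apply: E_row0.
  move: hn fn; rewrite eN /= => /eqP ->; rewrite /touch n00; lia.
have eN' : N = N1 ++ n' :: n :: N2 by rewrite eN cat_rcons.
by apply: (E_around_step eN' _ fn) => f'; exact: (IH n' (n :: N2) eN' f').
Qed.

(** By induction along N no face that touches N is in E ([E_around]).  So E can be
    left neither across N nor across another edge, and a face in E has all the
    faces on its left in E; far to the left M does not pass at all. *)
Lemma frontier (f : pt) : 0 <= f.2 < H -> wind f N <= 0 -> wind f M <= 0.
Proof.
move=> fr hf; rewrite leNgt; apply/negP => hfM.
have Ef : E f by rewrite /E fr hf /=; lia.
have step (i j : int) : E (cell (i + 1) j) -> E (cell i j).
  case: (boolP (cell (i + 1) j \in N)) => hN.
    by rewrite (E_around hN) // /touch /= !eqxx.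
  by rewrite E_right //; exact: unusedl.
have far k : E (cell (f.1 - k%:Z) f.2).
  elim: k => [|k IH]; first by rewrite subr0; case: (f) Ef.
  by apply: step; have -> : f.1 - k.+1%:Z + 1 = f.1 - k%:Z by lia.
have [k hk] : exists k : nat, {in M, forall u : pt, f.1 - k%:Z < u.1}.
  elim: M => [|u P [k hk]]; first by exists 0%N.
  exists (k + `|f.1 - u.1| + 1)%N => w; rewrite in_cons => /orP[/eqP->|/hk]; lia.
have := far k; rewrite /E [wind _ M]wind_far_left ?andbF //.
Qed.
End Frontier.

(** * Rerouting a simple line through a point on its right *)

Lemma steps_cons u v P : steps [:: u, v & P] = (u, v) :: steps (v :: P).
Proof. by []. Qed.

Lemma steps_cat P y Q s :
  s \in steps (P ++ y :: Q) = (s \in steps (rcons P y)) || (s \in steps (y :: Q)).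
Proof.
elim: P => [|u [|v P] IH] //; first by rewrite !cat_cons cat0s !rcons_cons steps_cons steps_cons !inE.
by rewrite !cat_cons !rcons_cons steps_cons steps_cons !in_cons -orbA -IH.
Qed.

Lemma split_first (T : eqType) (p : pred T) s : has p s ->
  exists s1 v s2, [/\ s = s1 ++ v :: s2, p v & ~~ has p s1].
Proof.
elim: s => //= u s IH; case pu: (p u) => /=; first by exists [::], u, s.
case/IH => s1 [v [s2 [-> pv h]]]; exists (u :: s1), v, s2.
by rewrite /= pu.
Qed.

Lemma split_last (T : eqType) (p : pred T) s : has p s ->
  exists s1 v s2, [/\ s = s1 ++ v :: s2, p v & ~~ has p s2].
Proof.
rewrite -has_rev => /split_first[s1 [v [s2 [e pv h]]]].
exists (rev s2), v, (rev s1); split => //; last by rewrite has_rev.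
by rewrite -[s]revK e rev_cat rev_cons cat_rcons.
Qed.

Section Good.
Variables (H : int) (n0 n1 : pt) (N : seq pt).
Hypothesis lN : line H n0 n1 N.

(** No edge at a vertex off N is used by N, so the count is constant around it. *)
Lemma around_eq w f f' : w \notin N -> 0 <= w.2 <= H -> touch f w -> touch f' w ->
  0 <= f.2 < H -> 0 <= f'.2 < H -> wind f N = wind f' N.
Proof.
move=> wN rw; case: (lN) => /and4P[_ _ _ sN] _ _ _.
case: w wN rw => a b wN /= rw.
have hR (j : int) : (j = b) \/ (j = b - 1) -> wind (cell a j) N = wind (cell (a - 1) j) N.
  case=> ->; have := @wind_right (a - 1) _ N sN; rewrite subrK => h; apply: h.
    exact: unusedl.
  by rewrite subrK; exact: unusedr.
have hU (i : int) : (i = a) \/ (i = a - 1) -> 0 < b < H -> wind (cell i (b - 1)) N = wind (cell i b) N.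
  case=> -> hb.
    have := @line_up H n0 n1 N a (b - 1) lN; rewrite subrK => h; apply: h => //.
    exact: unusedl.
  have := @line_up H n0 n1 N (a - 1) (b - 1) lN; rewrite !subrK => h; apply: h => //.
  exact: unusedr.
have hU' : b - 1 >= 0 -> b < H -> wind (cell a (b - 1)) N = wind (cell a b) N.
  by move=> h1 h2; apply: hU; [left|lia].
case: f f' => x y [x' y']; rewrite /touch /=.
move=> /andP[/orP[]/eqP-> /orP[]/eqP->] /andP[/orP[]/eqP-> /orP[]/eqP->] h1 h2;
  rewrite -?hR; try (by [left | right]); try done; rewrite ?hU' //; lia.
Qed.

(** The two vertices have a common face in the strip, and the count is constant
    around each of them. *)
Lemma good_adj w w' : good H N w -> adj w w' -> w' \notin N -> 0 <= w.2 <= H -> 0 <= w'.2 <= H ->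
  (w.2 != H) || (w'.2 != H) -> good H N w'.
Proof.
move=> [wN gw] ad w'N rw rw' nH; split => // f fw' hf.
have [f0 [t0 t0' h0]] : exists f0, [/\ touch f0 w, touch f0 w' & 0 <= f0.2 < H].
  move: ad nH rw rw'; rewrite /adj /touch; case: (w) => a b; case: (w') => c d /=.
  case/orP => /andP[/eqP-> /orP[]/eqP->] nH rw rw'.
  - by exists (cell c b) => /=; split; lia.
  - by exists (cell c d) => /=; split; lia.
  - by exists (cell a d) => /=; split; lia.
  - by exists (cell c d) => /=; split; lia.
by rewrite (around_eq w'N rw' fw' t0' hf h0); apply: gw.
Qed.

Lemma good_path t u C : path adj u C -> good H N u ->
  {in u :: C, forall w : pt, [/\ w \notin N, 0 <= w.2 <= H & w.2 = H -> w = t]} ->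
  {in u :: C, forall w, good H N w}.
Proof.
elim: C u => [|v C IH] u; first by move=> _ g _ w; rewrite inE => /eqP ->.
move=> /= /andP[uv pC] g hC w; rewrite inE => /orP[/eqP->//|wC].
apply: (IH v pC) wC => [|z hz]; last by apply: hC; rewrite in_cons hz orbT.
have [_ ru tu] := hC u (mem_head _ _).
have [vN rv tv] : [/\ v \notin N, 0 <= v.2 <= H & v.2 = H -> v = t].
  by apply: hC; rewrite !in_cons eqxx orbT.
apply: (good_adj g) => //; rewrite -negb_and; apply/negP => /andP[/eqP/tu e1 /eqP/tv e2].
move: uv; rewrite e1 e2 /adj; lia.
Qed.
End Good.

Lemma has_notin (N : seq pt) C : ~~ has (mem N) C -> {in C, forall u, u \notin N}.
Proof. by move=> /hasPn h u /h. Qed.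

(** If A2 meets N, follow N from its bottom end up to the last vertex v of A2 that
    is on N, then A2 from v to x2; otherwise keep A2.  As A2 avoids B, the vertex v is in the lower part of
    N, and everything after v is on the same side of N as x2. *)
Lemma reroute_low (H : int) n0 n1 N Na y Nb A B x2 A2 :
  0 < H -> line H n0 n1 N -> uniq N -> N = Na ++ y :: Nb -> {subset rcons Na y <= A} -> {subset y :: Nb <= B} ->
  {in A, forall u : pt, u.2 < H} ->
  low H x2 A2 -> disjoint A2 B -> x2 \notin N -> good H N x2 ->
  exists b A3, [/\ walk b x2 (rcons A3 x2), b = n0 \/ good H N b, low H x2 (rcons A3 x2),
    {subset rcons A3 x2 <= A ++ A2} &
    forall a c, (a, c) \in steps (rcons A3 x2) -> (a, c) \in steps N \/ good H N a \/ good H N c].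
Proof.
move=> H0 lN uN eN sA sB hA lA2 dB x2N gx2.
have [b2 [wA2 b20 x20 rA2]] := lA2.
have [b2' [_ _ _ rA2']] := low_rows lA2.
have steps_good C a c : {in C, forall w, good H N w} -> (a, c) \in steps C -> good H N a \/ good H N c.
  by move=> h /stepsP[hc _]; left; apply: h.
have gC C z : {subset C <= A2} -> ~~ has (mem N) C -> walk z x2 C -> {in C, forall w, good H N w}.
  move=> sC /has_notin CN; rewrite walk_rev => /and4P[+ + _ +] w.
  rewrite -mem_rev; case: (rev C) (mem_rev C) => // x C' eC _ /eqP /= ex sC'.
  rewrite ex in sC' eC *.
  apply: (good_path lN sC' gx2 (t := x2)) => v; rewrite eC => vC.
  by split; [exact: CN | have [] := rA2' _ (sC _ vC); lia | have [] := rA2' _ (sC _ vC); lia].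
case: (boolP (has (mem N) A2)) => [/split_last[P [v [Q [eA vN hQ]]]]|hno]; last first.
  have [A3 eA3] : exists A3, A2 = rcons A3 x2.
    case/and4P: wA2; case/lastP: (A2) => // s z _ _ + _.
    by rewrite last_rcons => /eqP ->; exists s.
  exists b2, A3; rewrite -eA3; split => //.
  - right; apply: (gC A2 b2) => //; by case/andP: (walk_mem wA2).
  - by move=> u; rewrite mem_cat orbC => ->.
  - by move=> a c /(steps_good A2) h; right; apply: h; exact: (gC A2 b2).
have {}vN : v \in N := vN.
have vA2 : v \in A2 by rewrite eA mem_cat inE eqxx orbT.
have vNa : v \in Na.
  have := dB _ vA2; move: (vN); rewrite eN mem_cat => /orP[//|/sB ->] //.
case/splitPr: vNa eN sA => N1 N2 eN sA.
rewrite -catA /= in eN.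
have [Q' eQ] : exists Q', Q = rcons Q' x2.
  case/and4P: (wA2) => _ _ + _; rewrite eA last_cat /=.
  case/lastP: Q {eA hQ} => [|s z] /eqP /=; first by move=> e; move: x2N; rewrite -e vN.
  by rewrite last_rcons => ->; exists s.
have [w1 w2] : walk n0 v (rcons N1 v) /\ walk v x2 (v :: Q).
  split; first by case: lN => + _ _ _; rewrite eN => /walk_split[].
  by move: wA2; rewrite eA => /walk_split[].
have sub1 : {subset rcons N1 v <= A}.
  by move=> u h; apply: sA; rewrite -cat_rcons rcons_cat mem_cat h.
have gQ : {in Q, forall w, good H N w}.
  case: Q eQ eA w2 hQ => [|q Q] eQ eA w2 hQ; first by [].
  apply: (gC _ q) => //; first by move=> u hu; rewrite eA mem_cat !inE in hu *; case/orP: hu => ->; rewrite ?orbT.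
  by have /= := @walk_split v x2 [:: v] q Q w2; case.
exists n0, (N1 ++ v :: Q').
have e3 : rcons (N1 ++ v :: Q') x2 = N1 ++ v :: Q by rewrite rcons_cat /= -eQ.
rewrite e3; have w3 := walk_cat w1 w2.
have sub3 : {subset N1 ++ v :: Q <= A ++ A2}.
  move=> u; rewrite -cat_rcons !mem_cat => /orP[/sub1->//|hu].
  by rewrite eA mem_cat !inE hu !orbT.
split => //; first by left.
- exists n0; split => //; first by case: lN.
  move=> u hu; have uN1 : u \in behead (N1 ++ [:: v]) \/ u \in Q.
    move: hu; rewrite -cat_rcons -cats1; case: (N1 ++ [:: v]) => [|z s] /= hu.
      by right; exact: mem_behead.
    by apply/orP; rewrite -mem_cat.
  case: uN1 => hu1; last first.
    by apply: rA2; rewrite eA; case: (P) => [|z s] //=; rewrite mem_cat inE hu1 !orbT.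
  have uA : u.2 < H by apply: hA; apply: sub1; rewrite -cats1; exact: mem_behead.
  have [_ _ _ /(_ u)] := lN; rewrite eN -cat_rcons -cats1 mem_cat (mem_behead hu1) => /(_ isT)[r0 z0 _].
  rewrite uA andbT lt_neqAle eq_sym; apply/andP; split; last by case/andP: r0.
  apply/eqP => /z0 eu; move: uN; rewrite eN -cat_rcons -cats1.
  have : head n0 (N1 ++ [:: v]) = n0.
    by case: lN => /and4P[_ /eqP + _ _] _ _ _; rewrite eN; case: (N1).
  by case: (N1 ++ [:: v]) hu1 => //= z s hz ->; rewrite mem_cat -eu hz.
- move=> a c; rewrite steps_cat => /orP[h|h].
    by left; rewrite eN steps_cat h.
  right; case: (Q) h gQ => [//|q Q0] + gQ; rewrite steps_cons in_cons.
  case/orP => [/eqP[-> ->]|/steps_good]; first by right; apply: gQ; rewrite mem_head.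
  by apply.
Qed.

Lemma steps_belast P u a c : (a, c) \in steps (rcons P u) -> a \in P.
Proof.
elim: P => [|v [|w P] IH] //; rewrite !rcons_cons steps_cons in_cons => /orP[/eqP[-> _]|//].
- exact: mem_head.
- exact: mem_head.
by rewrite -rcons_cons => /IH h; rewrite in_cons h orbT.
Qed.

(** Mirror image of [reroute_low]: follow B2 from x2 to its first vertex on N, then
    N to the top. *)
Lemma reroute_high (H : int) n0 n1 N Na y Nb A B x2 B2 :
  0 < H -> line H n0 n1 N -> uniq N -> N = Na ++ y :: Nb ->
  {subset rcons Na y <= A} -> {subset y :: Nb <= B} ->
  {in B, forall u : pt, 0 < u.2} ->
  high H x2 B2 -> disjoint B2 A -> x2 \notin N -> good H N x2 ->
  exists t B3, [/\ walk x2 t (x2 :: B3), high H x2 (x2 :: B3),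
    {subset x2 :: B3 <= B ++ B2} &
    forall a c, (a, c) \in steps (x2 :: B3) -> (a, c) \in steps N \/ good H N a \/ good H N c].
Proof.
move=> H0 lN uN eN sA sB hB hB2 dA x2N gx2.
have [t2 [wB2 t20 x20 rB2]] := hB2.
have [t2' [_ _ _ rB2']] := high_rows hB2.
have gC C z : {subset C <= B2} -> ~~ has (mem N) C -> walk x2 z C -> {in C, forall w, good H N w}.
  move=> sC /has_notin CN /and4P[C0 /eqP ex _ sC'].
  case: C C0 ex sC sC' CN => // x C _ /= -> sC sC' CN.
  apply: (good_path lN sC' gx2 (t := t2')) => v vC.
  by have [r e] := rB2' _ (sC _ vC); split => //; [exact: CN | lia].
case: (boolP (has (mem N) B2)) => [/split_first[P [v [Q [eB vN hP]]]]|hno]; last first.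
  have [B3 eB3] : exists B3, B2 = x2 :: B3.
    by case/and4P: wB2; case: (B2) => // z s _ /= /eqP -> _ _; exists s.
  exists t2, B3; rewrite -eB3; split => //.
  - by move=> u; rewrite mem_cat orbC => ->.
  - by move=> a c /stepsP[ha _]; right; left; apply: (gC B2 t2).
have {}vN : v \in N := vN.
have vB2 : v \in B2 by rewrite eB mem_cat inE eqxx orbT.
have vNb : v \in Nb.
  by have := dA _ vB2; move: (vN); rewrite eN -cat_rcons mem_cat => /orP[/sA ->|].
case/splitPr: vNb eN sB => N1 N2 eN sB.
have [P' eP] : exists P', P = x2 :: P'.
  case/and4P: (wB2) => _ + _ _; rewrite eB; case: (P) => [|z s] /= /eqP e.
    by move: x2N; rewrite -e vN.
  by rewrite e; exists s.
have eN' : N = (Na ++ y :: N1) ++ v :: N2 by rewrite -catA.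
have [w1 w2] : walk x2 v (rcons P v) /\ walk v n1 (v :: N2).
  split; first by move: wB2; rewrite eB => /walk_split[].
  by case: lN => + _ _ _; rewrite eN' => /walk_split[].
have sub1 : {subset v :: N2 <= B}.
  by move=> u h; apply: sB; rewrite in_cons mem_cat h !orbT.
have gP : {in P, forall w, good H N w}.
  have sP : {subset P <= B2} by move=> u hu; rewrite eB mem_cat hu.
  case/lastP: (P) w1 sP hP => // s z w1 sP hP.
  by apply: (gC _ z) => //; move: w1; rewrite -cats1 -cats1 -catA => /walk_split[]; rewrite cats1.
exists n1, (P' ++ v :: N2).
have e3 : x2 :: (P' ++ v :: N2) = P ++ v :: N2 by rewrite eP.
rewrite e3; have w3 := walk_cat w1 w2.
have sub3 : {subset P ++ v :: N2 <= B ++ B2}.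
  move=> u; rewrite !mem_cat => /orP[hu|/sub1->//].
  by rewrite eB mem_cat hu !orbT.
split => //.
- exists n1; split => //; first by case: lN.
  move=> u; rewrite rev_cat => hu; have uN1 : u \in behead (rev (v :: N2)) \/ u \in P.
    move: hu; case: (rev (v :: N2)) => [|z s] /= hu.
      by right; rewrite -mem_rev; exact: mem_behead.
    by rewrite -[u \in P]mem_rev; apply/orP; rewrite -mem_cat.
  case: uN1 => hu1; last first.
    apply: rB2; rewrite eB rev_cat rev_cons; case: (rev Q) => [|z s] /=.
      by rewrite mem_rev.
    by rewrite mem_cat mem_rev hu1 orbT.
  have uvN : u \in v :: N2 by rewrite -mem_rev; exact: mem_behead.
  have uB : 0 < u.2 by apply: hB; apply: sub1.
  have [_ _ _ /(_ u)] := lN; rewrite eN' mem_cat uvN orbT => /(_ isT)[r0 _ z0].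
  rewrite uB /= lt_neqAle; apply/andP; split; last by case/andP: r0.
  apply/eqP => /z0 eu; move: uN; rewrite eN' cat_uniq => /and3P[_ _]; rewrite -rev_uniq.
  have : head n1 (rev (v :: N2)) = n1.
    by move: w2; rewrite walk_rev => /and4P[_ /eqP].
  by case: (rev (v :: N2)) hu1 => //= z s hz ->; rewrite -eu hz.
- move=> a c; rewrite steps_cat => /orP[/steps_belast h|h].
    by right; left; apply: gP.
  by left; rewrite eN' steps_cat h orbT.
Qed.

(** Follow A up to y, the last vertex of B that is on A, then B from y on, and
    erase the loops of both pieces: by the choice of y they do not meet again. *)
Lemma simple_line (H : int) x A B : low H x A -> high H x B ->
  exists n0 n1 N Na y Nb, [/\ line H n0 n1 N, uniq N, N = Na ++ y :: Nb,
    {subset rcons Na y <= A} & {subset y :: Nb <= B}].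
Proof.
move=> /low_rows[b [wA b0 x0 hA]] /high_rows[t [wB tH xH hB]].
have xA : x \in A by case/andP: (walk_mem wA).
have xB : x \in B by case/andP: (walk_mem wB).
have [P [y [Q [eB yA hQ]]]] : exists s1 v s2, [/\ B = s1 ++ v :: s2, mem A v & ~~ has (mem A) s2].
  by apply: split_last; apply/hasP; exists x.
have [wy] : walk y t (y :: Q) /\ y \in A.
  by split => //; move: wB; rewrite eB => /walk_split[].
case/and4P: wy => _ _ /= /eqP lt pQ yA'.
case/splitPr: yA' (wA) hA hQ => P' Q' /walk_split[+ _] hA hQ.
case ep: (rcons P' y) => [|b' s]; first by case: (P') ep.
case/and4P => _ /= /eqP eb /eqP ls ps; rewrite {}eb in ep ls ps.
case/shortenP: ps ls => s' ps' us' ss' ls'.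
case/shortenP: pQ lt => Nb pNb uNb sNb lt'.
have [Na eNa] : exists Na, b :: s' = rcons Na y.
  by rewrite lastI ls'; exists (belast b s').
have sub1 : {subset rcons Na y <= P' ++ y :: Q'}.
  move=> u; rewrite -eNa -cat_rcons mem_cat ep !in_cons => /orP[->//|/ss' ->].
  by rewrite orbT.
have sub2 : {subset y :: Nb <= B}.
  move=> u; rewrite eB mem_cat !in_cons => /orP[->|/sNb ->]; by rewrite !orbT.
have wN : walk b t (Na ++ y :: Nb).
  apply: walk_cat; rewrite /walk; first by rewrite -eNa /= eqxx ls' eqxx.
  by rewrite /= eqxx lt' eqxx.
exists b, t, (Na ++ y :: Nb), Na, y, Nb; split => //.
- split => // u; rewrite -cat_rcons mem_cat => /orP[/sub1 h|h].
    by have [h1 h2] := hA u h; split => // [|e]; [|exfalso; move: e]; clear -h1; lia.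
  have uN : u \in y :: Nb by rewrite in_cons h orbT.
  have [h1 h2] := hB u (sub2 u uN).
  by split => // [|e]; [|exfalso; move: e]; clear -h1; lia.
- rewrite -cat_rcons cat_uniq -eNa us'; have {uNb} -> : uniq Nb by case/andP: uNb.
  rewrite andbT andTb eNa; apply/hasPn => u /sNb h; apply/negP => /sub1.
  by move/hasPn: hQ => /(_ u h) /negP.
Qed.

(** The line that is rerouted through x2 stays to the right of N, so it has x3 on
    its left ([frontier]); its two ends may then be exchanged for A2 and B2 as the
    arms of x3 lead away from x3 without meeting any of them. *)
Lemma cross_line (H : int) n0 n1 N Na y Nb A1 B1 x2 A2 B2 x3 A3 B3 :
  line H n0 n1 N -> uniq N -> N = Na ++ y :: Nb ->
  {subset rcons Na y <= A1} -> {subset y :: Nb <= B1} ->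
  {in A1, forall u : pt, u.2 < H} -> {in B1, forall u : pt, 0 < u.2} ->
  low H x2 A2 -> high H x2 B2 -> low H x3 A3 -> high H x3 B3 ->
  disjoint A2 B1 -> disjoint B2 A1 -> disjoint A3 B1 -> disjoint A3 B2 ->
  disjoint B3 A1 -> disjoint B3 A2 ->
  1 <= wind x2 N -> wind x3 N <= 0 -> W A2 B2 x3 <= 0.
Proof.
move=> lN uN eN sA sB rA rB lA2 hB2 lA3 hB3 d21 d21' d31 d32 d31' d32' w2 w3.
have [b2 [wA2 b20 x20 rA2]] := low_rows lA2.
have [t2 [wB2 t2H x2H rB2]] := high_rows hB2.
have x2N : x2 \notin N.
  rewrite eN -cat_rcons mem_cat negb_or; apply/andP; split.
    apply/negP => /sA; apply/negP; apply: d21'; by case/andP: (walk_mem wB2).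
  apply/negP => h; have /negP := d21 x2 (proj2 (andP (walk_mem wA2))).
  by apply; apply: sB; rewrite in_cons h orbT.
have H0 : 0 < H by lia.
have gx2 : good H N x2.
  have rx : 0 <= x2.2 <= H by clear -x20 x2H; lia.
  have rx' : 0 <= x2.2 < H by clear -x20 x2H; lia.
  have tx : touch x2 x2 by rewrite /touch !eqxx.
  by split => // f tf hf; rewrite (around_eq lN x2N rx tf tx hf rx').
have [b [A' [wA' hb lA' subA stA]]] := reroute_low H0 lN uN eN sA sB rA lA2 d21 x2N gx2.
have [t [B' [wB' hB' subB stB]]] := reroute_high H0 lN uN eN sA sB rB hB2 d21' x2N gx2.
have -> : W A2 B2 x3 = W (rcons A' x2) (x2 :: B') x3.
  rewrite /W; congr (_ + _).
    apply: (swap_low lA2 lA' hB3 d32') => u hu; apply/negP => /subA; rewrite mem_cat.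
    by apply/negP; rewrite negb_or d31' // d32'.
  apply: (swap_high hB2 hB' lA3 d32) => u hu; apply/negP => /subB; rewrite mem_cat.
  by apply/negP; rewrite negb_or d31 // d32.
rewrite /W -wind_cat.
have [bb [wbb bb0 _ rbb]] := low_rows lA'.
have [tt [wtt ttH _ rtt]] := high_rows hB'.
have ebb : bb = b.
  by move: wbb wA'; case: (rcons A' x2) => // z s /and4P[_ /= /eqP <- _ _] /and4P[_ /= /eqP -> _ _].
have ett : tt = t.
  by move: wtt wB' => /and4P[_ _ /= /eqP <- _] /and4P[_ _ /= /eqP -> _].
rewrite ebb ett in bb0 ttH rbb rtt.
have lM : line H b t (A' ++ x2 :: B').
  split => //; first exact: walk_cat wA' wB'.
  move=> u; rewrite -cat_rcons mem_cat => /orP[/rbb[h1 h2]|h].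
    by split => // [|e]; [|exfalso; move: e]; clear -h1; lia.
  have uB : u \in x2 :: B' by rewrite in_cons h orbT.
  have [h1 h2] := rtt u uB.
  by split => // [|e]; [|exfalso; move: e]; clear -h1; lia.
have [b3 [_ _ x30 _]] := lA3; have [t3 [_ _ x3H _]] := hB3.
apply: (frontier H0 lN uN lM _ hb) => //; last by lia.
by move=> a c; rewrite steps_cat => /orP[/stA|/stB].
Qed.

(** * Periodic configurations in the strip *)

Lemma low_sh (H : int) c x A : low H x A -> low H (sh c x) (map (sh c) A).
Proof.
case=> b [wA b0 x0 hA]; exists (sh c b); split => //; first exact: walk_sh.
by move=> u; rewrite behead_map; case/mapP => v /hA hv ->.
Qed.

Lemma high_sh (H : int) c x B : high H x B -> high H (sh c x) (map (sh c) B).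
Proof.
case=> b [wB b0 x0 hB]; exists (sh c b); split => //; first exact: walk_sh.
move=> u; rewrite -map_rev behead_map.
by case/mapP => v /hB hv ->.
Qed.

Lemma W_sh c A B f : W (map (sh c) A) (map (sh c) B) f = W A B (sh (- c) f).
Proof. by rewrite /W !wind_sh. Qed.

Definition apart (K : int) (P Q : seq pt) : Prop :=
  forall k : int, {in P, forall u, sh (k * K) u \notin Q}.

Lemma apart_sym K P Q : apart K P Q -> apart K Q P.
Proof.
move=> h k u uQ; apply/negP => uP; have /negP := h (- k) _ uP; apply.
by rewrite sh_add mulNr addNr sh0.
Qed.

Lemma apart_disjoint K P Q (a b : int) : apart K P Q ->
  disjoint (map (sh (a * K)) P) (map (sh (b * K)) Q).
Proof.
move=> h u; rewrite !mem_sh => /(h (a - b)); rewrite sh_add.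
by have -> : (a - b) * K + - (a * K) = - (b * K) by lia.
Qed.

Lemma apart_disjointl K P Q (a : int) : apart K P Q -> disjoint (map (sh (a * K)) P) Q.
Proof.
move=> /(@apart_disjoint _ _ _ a 0); rewrite mul0r.
by rewrite (eq_map (sh0 : sh 0 =1 id)) map_id.
Qed.

Lemma apart_disjointr K P Q (a : int) : apart K P Q -> disjoint P (map (sh (a * K)) Q).
Proof. by move=> /apart_sym/(@apart_disjointl _ _ _ a)/disjoint_sym. Qed.

Lemma exists_last_int (p : pred int) (a b : int) : p a -> (forall j, b <= j -> ~~ p j) ->
  exists2 k, p k & forall j, k < j -> ~~ p j.
Proof.
move=> pa hb; have ab : a < b by rewrite ltNge; apply/negP => /hb; rewrite pa.
pose q (n : nat) := p (a + n%:Z).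
have q0 : exists n, q n by exists 0%N; rewrite /q addr0.
have qb n : q n -> (n <= `|b - a|)%N.
  move=> qn; rewrite leqNgt; apply/negP => h; have : ~~ p (a + n%:Z) by apply: hb; lia.
  by rewrite -/(q n) qn.
case: (ex_maxnP q0 qb) => n qn hn; exists (a + n%:Z) => // j hj; apply/negP => pj.
have := hn `|j - a|%N; rewrite /q.
have -> : a + `|j - a|%N%:Z = j by lia.
by move=> /(_ pj); lia.
Qed.

Lemma line_sh (H : int) c n m N : line H n m N -> line H (sh c n) (sh c m) (map (sh c) N).
Proof.
case=> wN n0 mH hN; split => //; first exact: walk_sh.
move=> u /mapP[v vN ->]; have [h1 h2 h3] := hN v vN.
by split=> // /= e; [rewrite h2 | rewrite h3].
Qed.

Lemma line_mid (H : int) n m N y z C : line H n m N -> walk y z C ->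
  {in C, forall u : pt, 0 < u.2 < H} -> disjoint C N -> wind y N = wind z N.
Proof.
move=> lN wC hC CN; case: (lN) => /and4P[_ _ _ sN] _ _ _.
pose ok (u : pt) := (u \notin N) && (0 < u.2 < H).
apply: (@walk_const (fun f => wind f N) ok _ _ _ _ _ wC) => [i j|i j|u uC].
- by case/andP => nN _; apply: wind_right => //; exact: unusedl.
- move=> _ /andP[nN /= hj]; apply: (line_up lN) => //; exact: unusedl.
- by rewrite /ok CN //= hC.
Qed.

Lemma line_far_left (H : int) n m N (f : pt) (K : int) : 0 < K -> line H n m N ->
  exists b : int, forall j : int, b <= j -> wind (sh (- (j * K)) f) N = 0.
Proof.
move=> K0 lN.
have [k hk] : exists k : int, {in N, forall u : pt, f.1 - k < u.1}.
  elim: N {lN} => [|u P [k hk]]; first by exists 0.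
  exists (`|k| + `|f.1 - u.1| + 1) => w; rewrite in_cons => /orP[/eqP->|/hk]; lia.
exists `|k| => j hj; apply: wind_far_left => u /hk /=; nia.
Qed.

Lemma line_far_right (H : int) n m N (f : pt) (K : int) : 0 < K -> line H n m N -> 0 <= f.2 < H ->
  exists j : int, wind (sh (- (j * K)) f) N = 1.
Proof.
move=> K0 lN hf.
have [k hk] : exists k : int, {in N, forall u : pt, u.1 <= f.1 + k}.
  elim: N {lN} => [|u P [k hk]]; first by exists 0.
  exists (`|k| + `|f.1 - u.1| + 1) => w; rewrite in_cons => /orP[/eqP->|/hk]; lia.
exists (- `|k|); case: (lN) => wN n0 mH _; rewrite (wind_far_right _ wN); last first.
  by move=> u /hk /=; nia.
rewrite /= n0 mH; lia.
Qed.

Section Star.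
Variables (I : eqType) (K H : int) (x : I -> pt) (A B : I -> seq pt).
Hypotheses (K0 : 0 < K) (lowA : forall i, low H (x i) (A i)) (highB : forall i, high H (x i) (B i)).
Hypothesis AB : forall i j, i != j -> apart K (A i) (B j).
Let w i f := W (A i) (B i) f.

(** Here C is the side opposite to the corner i; it leads from the corner j to the
    s-th translate of the corner m. *)
Definition link (i j m : I) (s : int) : Prop :=
  exists C, [/\ walk (x j) (sh (s * K) (x m)) C, {in C, forall u : pt, 0 < u.2 < H},
    apart K C (A i) & apart K C (B i)].

Lemma xrow i : 0 < (x i).2 < H.
Proof. by have [b [_ _ h1 _]] := lowA i; have [t [_ _ h2 _]] := highB i; lia. Qed.

(** The argument is in the introduction.  Here kap is the last translate of N with
    x j on its right, and the line that is rerouted is the translate of N by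
    kap + k periods. *)
Lemma star i j m s (k : int) : i != j -> i != m -> j != m -> link i j m s -> 1 <= k ->
  w j (sh ((s - k) * K) (x m)) <= 0.
Proof.
move=> ij im jm [C [wC rC CA CB]] k1.
have [n0 [n1 [N [Na [y [Nb [lN uN eN sA sB]]]]]]] := simple_line (lowA i) (highB i).
have NC : apart K C N.
  move=> c u uC; apply/negP; rewrite eN -cat_rcons mem_cat => /orP[/sA|h].
    by apply/negP; exact: CA.
  by have := CB c u uC; rewrite sB // in_cons h orbT.
pose p (j0 : int) := 1 <= wind (sh (- (j0 * K)) (x j)) N.
have [kap pkap hkap] : exists2 k0, p k0 & forall j0, k0 < j0 -> ~~ p j0.
  have [b hb] := line_far_left (x j) K0 lN.
  have rx : 0 <= (x j).2 < H by have := xrow j; lia.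
  have [a ha] := line_far_right K0 lN rx.
  by apply: (@exists_last_int _ a b) => [|j0 /hb]; rewrite /p ?ha // => ->.
pose c := (kap + k) * K.
have -> : w j (sh ((s - k) * K) (x m)) =
    W (map (sh (k * K)) (A j)) (map (sh (k * K)) (B j)) (sh (s * K) (x m)).
  by rewrite W_sh sh_add; have -> : - (k * K) + s * K = (s - k) * K by lia.
apply: (@cross_line H (sh c n0) (sh c n1) (map (sh c) N) (map (sh c) Na) (sh c y) (map (sh c) Nb)
  (map (sh c) (A i)) (map (sh c) (B i)) (sh (k * K) (x j)) _ _ _
  (map (sh (s * K)) (A m)) (map (sh (s * K)) (B m))).
- exact: line_sh.
- by rewrite map_inj_uniq //; exact: (can_inj (shK c)).
- by rewrite eN map_cat.
- by move=> u; rewrite -map_rcons => /mapP[v /sA hv ->]; apply: map_f.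
- by move=> u; rewrite -map_cons => /mapP[v /sB hv ->]; apply: map_f.
- move=> u /mapP[v vA ->] /=; have [b [_ _ _ /(_ v vA)]] := low_rows (lowA i); lia.
- move=> u /mapP[v vA ->] /=; have [b [_ _ _ /(_ v vA)]] := high_rows (highB i); lia.
- exact: low_sh.
- exact: high_sh.
- exact: low_sh.
- exact: high_sh.
- by apply: apart_disjoint; apply: AB; rewrite eq_sym.
- by apply: apart_disjoint; apply: apart_sym; exact: AB.
- by apply: apart_disjoint; apply: AB; rewrite eq_sym.
- by apply: apart_disjoint; apply: AB; rewrite eq_sym.
- by apply: apart_disjoint; apply: apart_sym; exact: AB.
- by apply: apart_disjoint; apply: apart_sym; exact: AB.
- rewrite wind_sh sh_add; have -> : - c + k * K = - (kap * K) by rewrite /c; lia.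
  exact: pkap.
- have e : wind (x j) (map (sh c) N) = wind (sh (s * K) (x m)) (map (sh c) N).
    by apply: (line_mid (line_sh c lN) wC rC); exact: apart_disjointr.
  rewrite -e wind_sh; have /hkap : kap < kap + k by lia.
  rewrite /p /c; lia.
Qed.

Lemma dual i j c : i != j -> w i (sh (c * K) (x j)) + w j (sh (- c * K) (x i)) = 1.
Proof.
move=> ij; rewrite -(@duality H (x i) (A i) (B i) (sh (c * K) (x j)) (map (sh (c * K)) (A j)) (map (sh (c * K)) (B j))) //.
- by rewrite W_sh mulNr.
- exact: low_sh.
- exact: high_sh.
- by apply: apart_disjointr; exact: AB.
- by apply: apart_disjointr; apply: apart_sym; apply: AB; rewrite eq_sym.
Qed.

Lemma aligned i j m s c : link i j m s -> w i (sh (c * K) (x j)) = w i (sh ((c + s) * K) (x m)).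
Proof.
move=> [C [wC rC CA CB]].
have := @W_mid H (sh (- c * K) (x i)) (map (sh (- c * K)) (A i)) (map (sh (- c * K)) (B i)) _ _ C
  (low_sh _ (lowA i)) (high_sh _ (highB i)) wC rC (apart_disjointr _ CA) (apart_disjointr _ CB).
rewrite !W_sh sh_add /w mulNr opprK => ->; congr (W _ _ (sh _ _)); lia.
Qed.

Lemma link_rev i j m s : link i j m s -> link i m j (- s).
Proof.
move=> [C [wC rC CA CB]]; exists (map (sh (- s * K)) (rev C)); split.
- move: wC; rewrite walk_rev => /(@walk_sh (- s * K)).
  by rewrite sh_add mulNr addNr sh0.
- by move=> u /mapP[v]; rewrite mem_rev => /rC h ->.
- move=> k u /mapP[v]; rewrite mem_rev => vC ->; rewrite sh_add -mulrDl; exact: CA.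
- move=> k u /mapP[v]; rewrite mem_rev => vC ->; rewrite sh_add -mulrDl; exact: CB.
Qed.

(** Let S = s1 + s2 + s3 >= 2.  On the side opposite to i3, [star] with k = S - 1
    bounds w i1 at a translate of x i2; by [aligned] this is a bound at a translate
    of x i3.  On the side opposite to i2, [star] with k = 1 bounds w i3 at the
    matching translate of x i1.  Both numbers are at most 0, yet by [duality] they
    add up to 1. *)
Lemma no_big i1 i2 i3 s1 s2 s3 : i1 != i2 -> i2 != i3 -> i1 != i3 ->
  link i3 i1 i2 s3 -> link i1 i2 i3 s1 -> link i2 i3 i1 s2 -> s1 + s2 + s3 < 2.
Proof.
move=> n12 n23 n13 L3 L1 L2; rewrite ltNge; apply/negP => hl.
have h1 := @star i3 i1 i2 s3 (s1 + s2 + s3 - 1).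
have {h1} := h1 _ _ _ L3 _; rewrite eq_sym n13 eq_sym n23 n12 => /(_ isT isT isT) h1.
have h2 := @star i2 i3 i1 s2 1 _ _ _ L2; rewrite n23 eq_sym n12 eq_sym n13 in h2.
have {}h2 := h2 isT isT isT isT.
have h3 := @dual i3 i1 (s2 - 1); rewrite eq_sym n13 in h3; have {}h3 := h3 isT.
have h4 := aligned (1 - s2 - s1) L1.
have {}h1 : w i1 (sh ((1 - s2 - s1) * K) (x i2)) <= 0.
  have -> : 1 - s2 - s1 = s3 - (s1 + s2 + s3 - 1) by lia.
  by apply: h1; lia.
move: h1 h2 h3; rewrite h4.
have -> : 1 - s2 - s1 + s1 = - (s2 - 1) by lia.
by move: (w i1 _) (w i3 _); clear; lia.
Qed.

(** For l <= -2 read the triangle in the order i1, i3, i2. *)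
Theorem strip_theorem i1 i2 i3 l : i1 != i2 -> i2 != i3 -> i1 != i3 ->
  link i3 i1 i2 0 -> link i1 i2 i3 0 -> link i2 i3 i1 l -> l = 1 \/ l = -1.
Proof.
move=> n12 n23 n13 L3 L1 L2.
have h1 := no_big n12 n23 n13 L3 L1 L2.
have h2 : - l < 2.
  have := @no_big i1 i3 i2 0 0 (- l) n13.
  rewrite eq_sym n23 n12 => /(_ isT isT (link_rev L2)).
  have := link_rev L3; have := link_rev L1; rewrite oppr0 => a b /(_ a b); lia.
suff : l <> 0 by lia.
move=> l0; rewrite {}l0 in L2.
have a1 := aligned 0 L1; have a2 := aligned 0 L2; have a3 := aligned 0 L3.
have d1 := dual 0 n12; have d2 := dual 0 n23; have d3 := dual 0 n13.
move: a1 a2 a3 d1 d2 d3; rewrite oppr0 !addr0.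
move: (w i1 _) (w i1 _) (w i2 _) (w i2 _) (w i3 _) (w i3 _); clear; lia.
Qed.
End Star.

(** * Polar angles along plane curves *)

(** The supremum of the points of [a, b] where Q holds is b: the local hypothesis
    carries Q from below the supremum to above it.  Constructions along a compact
    interval are reduced to small steps in this way, without a subdivision. *)
Lemma real_induction (R : realType) (Q : R -> Prop) (a b : R) : a <= b -> Q a ->
  (forall s, a <= s <= b -> exists2 e, 0 < e &
     forall t t', a <= t <= b -> a <= t' <= b -> `|t - s| < e -> `|t' - s| < e -> Q t -> Q t') ->
  Q b.
Proof.
move=> ab Qa loc; pose S := [set t | a <= t <= b /\ Q t].
have Sa : S a by split => //; rewrite lexx.
have hS : has_sup S by split; [exists a | exists b => t [/andP[]]].
have aS : a <= sup S <= b.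
  rewrite (sup_upper_bound hS) //=; apply: ge_sup; first by exists a.
  by move=> t [/andP[]].
have [e e0 he] := loc _ aS; have [t [tab Qt] tS] := sup_adherent e0 hS.
have ts : t <= sup S by exact: (sup_upper_bound hS).
have [h|h] := leP b (sup S + e / 2).
  by apply: (he t b) => //; rewrite ?ab ?lexx ?ltr_norml //; lra.
have Qs : Q (sup S + e / 2) by apply: (he t) => //; rewrite ?ltr_norml; lra.
have : sup S + e / 2 <= sup S by apply: (sup_upper_bound hS); split => //; lra.
by lra.
Qed.

Lemma continuous_eps (R : realType) (f : R -> R) s : {for s, continuous f} ->
  forall e, 0 < e -> exists2 d, 0 < d & forall t, `|t - s| < d -> `|f t - f s| < e.
Proof.
move=> /cvgrPdist_lt h e e0; have := h e e0; move/nbhs_ballP => [d /= d0 hd].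
exists d => // t ts; rewrite distrC; apply: hd.
by rewrite /ball /= distrC.
Qed.

Section Trigo.
Variable R : realType.
Implicit Types x y : R.

Lemma cos_sin_shift x (m : int) :
  cos (x + 2 * pi * m%:~R) = cos x /\ sin (x + 2 * pi * m%:~R) = sin x.
Proof.
have e : 2 * pi = pi *+ 2 :> R by rewrite mulr_natl.
have key (n : nat) y : cos (y + 2 * pi * n%:R) = cos y /\ sin (y + 2 * pi * n%:R) = sin y.
  by rewrite e mulr_natr (periodicn (@cosD2pi R)) (periodicn (@sinD2pi R)).
case: m => n; first exact: key.
have [h1 h2] := key n.+1 (x + 2 * pi * (Negz n)%:~R).
by rewrite -h1 -h2 NegzE mulrNz mulrN subrK.
Qed.

(** Reduce x - y modulo 2 pi to z in [0, 2 pi[; then cos z = 1, and half of z has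
    sine 0 in [0, pi[. *)
Lemma cos_sin_inj x y : cos x = cos y -> sin x = sin y -> exists m : int, x - y = 2 * pi * m%:~R.
Proof.
move=> hc hs; have pi0 := pi_gt0 R.
pose m := Num.floor ((x - y) / (2 * pi)); exists m.
pose z := x - y - 2 * pi * m%:~R.
have hz : 0 <= z < 2 * pi.
  have /andP[h1 h2] := floor_itv ((x - y) / (2 * pi)); rewrite -/m in h1 h2.
  move: h1 h2; rewrite intrD ler_pdivlMr ?ltr_pdivrMr; try lra.
  rewrite /z; lra.
have cz : cos z = 1.
  rewrite /z -[X in cos X]/(x - y + - (2 * pi * m%:~R)) -mulrN -mulrNz.
  by rewrite (proj1 (cos_sin_shift _ _)) cosB hc hs -!expr2 cos2Dsin2.
have : sin (z / 2) = 0.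
  have e : z = (z / 2) *+ 2 by rewrite -mulr_natr divfK ?pnatr_eq0.
  move: cz; rewrite {1}e cos_mulr2n cos2sin2 => h.
  apply/eqP; rewrite -sqrf_eq0; apply/eqP; move: h; rewrite mulrnBl; lra.
move=> sz; have [z0|z0] := ltP 0 z.
  by have := @sin_gt0_pi R (z / 2); rewrite sz ltxx => h; have : is_true false by apply: h; lra.
rewrite /z in hz z0; lra.
Qed.

Lemma cos_lip x y : `|cos x - cos y| <= `|x - y|.
Proof.
wlog h : x y / y <= x => [hw|].
  have [|/ltW] := leP y x; first exact: hw.
  by move=> /hw; rewrite distrC (distrC y).
have cc : {within `[y, x], continuous (@cos R)}.
  by apply: continuous_subspaceT; exact: continuous_cos.
have [c _ ->] := @MVT_segment R cos (fun z => - sin z) y x h (fun z _ => is_derive_cos z) cc.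
by rewrite normrM normrN ler_piMl // sin_max.
Qed.

Lemma sin_lip x y : `|sin x - sin y| <= `|x - y|.
Proof. by rewrite -!cosBpihalf (le_trans (cos_lip _ _)) // opprB addrA subrK. Qed.

(** The angle between the two unit vectors is asin of their determinant X, as long
    as their scalar product is nonnegative. *)
Lemma small_angle e : 0 < e -> exists2 d, 0 < d & forall c s c' s' : R,
  c ^+ 2 + s ^+ 2 = 1 -> c' ^+ 2 + s' ^+ 2 = 1 -> `|c' - c| < d -> `|s' - s| < d ->
  forall th, cos th = c -> sin th = s -> exists th', [/\ cos th' = c', sin th' = s' & `|th' - th| < e].
Proof.
move=> e0; have c0 : {for 0, continuous (@asin R)} by apply: continuous_asin; lra.
have [d d0 hd] := continuous_eps c0 e0.
exists (Num.min (d / 2) (1/2)); first by rewrite lt_min; lra.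
move=> c s c' s' h h'; rewrite !lt_min => /andP[hc1 hc2] /andP[hs1 hs2] th tc ts.
pose X := s' * c - c' * s; pose D := c' * c + s' * s.
have DX : D ^+ 2 + X ^+ 2 = 1.
  by rewrite -[RHS](mulr1 1) -{1}h -h' /D /X; ring.
have nc : `|c| <= 1 by rewrite -tc cos_max.
have ns : `|s| <= 1 by rewrite -ts sin_max.
have X1 : -1 <= X <= 1 by have := sqr_ge0 D; nra.
have D0 : 0 <= D.
  have -> : D = 1 - ((c' - c) ^+ 2 + (s' - s) ^+ 2) / 2 by rewrite /D; lra.
  have : (c' - c) ^+ 2 <= 1 / 4.
    by rewrite -real_normK ?num_real //; have := normr_ge0 (c' - c); nra.
  have : (s' - s) ^+ 2 <= 1 / 4.
    by rewrite -real_normK ?num_real //; have := normr_ge0 (s' - s); nra.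
  lra.
have Xd : `|X - 0| < d.
  have -> : X - 0 = (s' - s) * c - (c' - c) * s by rewrite /X; ring.
  have := ler_normB ((s' - s) * c) ((c' - c) * s); rewrite !normrM.
  have := normr_ge0 (s' - s); have := normr_ge0 (c' - c); nra.
have asin0 : asin (0 : R) = 0.
  by rewrite -{1}(@sin0 R) sinK // in_itv /=; have := pi_gt0 R; lra.
exists (th + asin X); rewrite cosD sinD cos_asin // asinK ?in_itv //= tc ts.
have -> : Num.sqrt (1 - X ^+ 2) = D.
  by rewrite -DX addrK sqrtr_sqr ger0_norm.
split; last by rewrite addrC addKr; have := hd X Xd; rewrite asin0 subr0.
- by rewrite -[RHS]mulr1 -[in RHS]h /X /D; ring.
- by rewrite -[RHS]mulr1 -[in RHS]h /X /D; ring.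
Qed.
End Trigo.

Section Lift.
Variable R : realType.
Implicit Types (x y : R -> R).

Lemma polar (c s : R) : 0 < c ^+ 2 + s ^+ 2 ->
  exists th, exists2 r, 0 < r & c = r * cos th /\ s = r * sin th.
Proof.
move=> h; pose r := Num.sqrt (c ^+ 2 + s ^+ 2).
have r0 : 0 < r by rewrite sqrtr_gt0.
have r2 : r ^+ 2 = c ^+ 2 + s ^+ 2 by rewrite sqr_sqrtr // ltW.
have cr : -1 <= c / r <= 1.
  have : `|c| <= r by rewrite -sqrtr_sqr ler_wsqrtr // lerDl sqr_ge0.
  by rewrite ler_norml ler_pdivlMr // ler_pdivrMr // mul1r mulN1r.
have sq : Num.sqrt (1 - (c / r) ^+ 2) = `|s| / r.
  have -> : 1 - (c / r) ^+ 2 = (s / r) ^+ 2.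
    have r0' : r != 0 by rewrite gt_eqF.
    by rewrite !exprMn !exprVn r2; field; rewrite -r2 expf_neq0.
  by rewrite sqrtr_sqr normrM normfV (gtr0_norm r0).
have [s0|s0] := leP 0 s.
  exists (acos (c / r)), r => //; rewrite acosK ?in_itv //= sin_acos // sq ger0_norm //.
  by rewrite !mulrA !(mulrC r) !mulfK // gt_eqF.
exists (- acos (c / r)), r => //; rewrite cosN sinN acosK ?in_itv //= sin_acos // sq ltr0_norm //.
by rewrite mulNr opprK !mulrA !(mulrC r) !mulfK // gt_eqF.
Qed.

Definition polar_at x y (th : R -> R) t :=
  exists2 r, 0 < r & x t = r * cos (th t) /\ y t = r * sin (th t).

(** Two vectors close to the same nonzero vector form an acute angle. *)
Lemma dot_gt0 (w1 w2 a1 a2 b1 b2 n : R) : n = `|w1| + `|w2| -> 0 < n ->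
  `|a1 - w1| < n / 8 -> `|a2 - w2| < n / 8 -> `|b1 - w1| < n / 8 -> `|b2 - w2| < n / 8 ->
  0 < a1 * b1 + a2 * b2.
Proof.
move=> en n0 h1 h2 h3 h4.
have e : a1 * b1 + a2 * b2 = w1 ^+ 2 + w2 ^+ 2 + (w1 * (a1 - w1) + w1 * (b1 - w1))
  + (w2 * (a2 - w2) + w2 * (b2 - w2)) + (a1 - w1) * (b1 - w1) + (a2 - w2) * (b2 - w2) by ring.
have lo (u v k : R) : `|v| < k -> - (`|u| * k) <= u * v.
  move=> hv; rewrite lerNl -mulrN (le_trans (ler_norm _)) // normrM normrN ler_wpM2l //.
  exact: ltW.
have := lo w1 _ _ h1; have := lo w1 _ _ h3; have := lo w2 _ _ h2; have := lo w2 _ _ h4.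
have := lo (a1 - w1) _ _ h3; have := lo (a2 - w2) _ _ h4.
have : n ^+ 2 <= 2 * (w1 ^+ 2 + w2 ^+ 2).
  rewrite en -(real_normK (num_real w1)) -(real_normK (num_real w2)).
  by have := sqr_ge0 (`|w1| - `|w2|); nra.
move: (normr_ge0 (a1 - w1)) (normr_ge0 (a2 - w2)).
rewrite e; nra.
Qed.

(** On a short interval the curve stays in a half plane, and the angle from its
    value at t is the arctangent of determinant over scalar product. *)
Lemma lift_exists x y (a b : R) : a <= b -> continuous x -> continuous y ->
  (forall t, a <= t <= b -> 0 < x t ^+ 2 + y t ^+ 2) ->
  exists th : R -> R, continuous th /\ forall t, a <= t <= b -> polar_at x y th t.
Proof.
move=> ab cx cy nz.
pose Q c := exists th : R -> R, continuous th /\ forall t, a <= t <= c -> polar_at x y th t.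
apply: (@real_induction _ Q a b ab).
  have aa : a <= a <= b by rewrite lexx.
  have [th [r r0 h]] := polar (nz a aa).
  exists (fun=> th); split; first by move=> ?; exact: cst_continuous.
  by move=> t; rewrite -eq_le => /eqP <-; exists r.
move=> s sab; pose n := `|x s| + `|y s|.
have n0 : 0 < n.
  rewrite lt_neqAle eq_sym paddr_eq0 // !normr_eq0 addr_ge0 // andbT.
  apply/negP => /andP[/eqP hx /eqP hy]; have := nz s sab.
  by rewrite hx hy expr0n addr0 ltxx.
have n8 : 0 < n / 8 by rewrite divr_gt0.
have [d1 d10 h1] := continuous_eps (cx s) n8; have [d2 d20 h2] := continuous_eps (cy s) n8.
exists (Num.min d1 d2); first by rewrite lt_min d10.
move=> t t' tab t'ab; rewrite !lt_min => /andP[ts1 ts2] /andP[ts1' ts2'] [th [cth hth]].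
have [tt'|tt'] := leP t' t.
  by exists th; split => // u /andP[u1 u2]; apply: hth; rewrite u1 (le_trans u2).
pose k u := Num.max t (Num.min u t').
have ck : continuous k.
  move=> u; apply: (@continuous_max R R (fun=> t) (fun u => Num.min u t')); first exact: cst_continuous.
  apply: (@continuous_min R R id (fun=> t')); first by [].
  exact: cst_continuous.
have kin u : t <= k u <= t'.
  by rewrite /k le_max lexx /= ge_max (ltW tt') ge_min lexx orbT.
have ks u : `|k u - s| < d1 /\ `|k u - s| < d2.
  have := kin u; move: ts1 ts2 ts1' ts2'; rewrite !ltr_norml; lra.
pose D u := x t * x (k u) + y t * y (k u).
pose X u := x t * y (k u) - y t * x (k u).
have D0 u : 0 < D u.
  by have [k1 k2] := ks u; apply: (@dot_gt0 (x s) (y s) _ _ _ _ n) => //; [exact: h1 | exact: h2 | exact: h1 | exact: h2].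
have cxk : continuous (x \o k) by move=> u; apply: continuous_comp; [exact: ck | exact: cx].
have cyk : continuous (y \o k) by move=> u; apply: continuous_comp; [exact: ck | exact: cy].
have cD : continuous D.
  by move=> u; apply: cvgD; apply: cvgM; try exact: cvg_cst; [exact: cxk | exact: cyk].
have cX : continuous X.
  by move=> u; apply: cvgB; apply: cvgM; try exact: cvg_cst; [exact: cyk | exact: cxk].
pose ph u := atan (X u / D u).
have cph : continuous ph.
  move=> u; apply: (@continuous_comp _ _ _ (fun u => X u / D u) (@atan R)); last exact: continuous_atan.
  by apply: cvgM; [exact: cX | apply: cvgV; [rewrite gt_eqF | exact: cD]].
exists (fun u => th (Num.min u t) + ph u); split.
  move=> u; apply: cvgD; last exact: cph.
  apply: (@continuous_comp _ _ _ (fun u => Num.min u t) th); last exact: cth.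
  by apply: (@continuous_min R R id (fun=> t)); [by [] | exact: cst_continuous].
move=> u /andP[au ut']; rewrite /polar_at; have [ut|ut] := leP u t.
  have -> : ph u = 0.
    have ku : k u = t by rewrite /k (min_l ut') (max_l ut).
    by rewrite /ph /X ku (mulrC (y t)) subrr mul0r atan0.
  by rewrite addr0; apply: hth; rewrite au.
have att : a <= t <= t by rewrite lexx andbT; case/andP: tab.
have [r r0 [e1 e2]] := hth t att.
have ku : k u = u by rewrite /k (min_l ut') (max_r (ltW ut)).
pose f := X u / D u.
have cf0 : 0 < cos (atan f) by rewrite cos_atan invr_gt0 sqrtr_gt0; have := sqr_ge0 f; lra.
have sf : sin (atan f) = f * cos (atan f).
  by rewrite -{2}[f]atanK /tan divfK // gt_eqF.
have Df := D0 u.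
have r2 : x t ^+ 2 + y t ^+ 2 = r ^+ 2.
  by rewrite e1 e2 !exprMn -mulrDr cos2Dsin2 mulr1.
exists (D u / (r * cos (atan f))); first by rewrite divr_gt0 // mulr_gt0.
rewrite -/f cosD sinD sf.
have ne1 : r != 0 by rewrite gt_eqF.
have ne2 : cos (atan f) != 0 by rewrite gt_eqF.
have ne3 : D u != 0 by rewrite gt_eqF.
have ex : x u * r ^+ 2 = D u * x t - X u * y t.
  by rewrite -r2 /D /X ku; ring.
have ey : y u * r ^+ 2 = D u * y t + X u * x t.
  by rewrite -r2 /D /X ku; ring.
split.
- apply: (@mulIf _ (r ^+ 2)); first by rewrite expf_neq0.
  rewrite ex e1 e2 /f; field; first by rewrite ne1 ne2 ne3.
- apply: (@mulIf _ (r ^+ 2)); first by rewrite expf_neq0.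
  rewrite ey e1 e2 /f; field; first by rewrite ne1 ne2 ne3.
Qed.
End Lift.

(** * Bipolar coordinates *)

Section Bipolar.
Variables (R : realType) (p q : R * R).
Hypothesis pq : p != q.
Implicit Types z w : R * R.

Definition dst z w : R := Num.sqrt ((z.1 - w.1) ^+ 2 + (z.2 - w.2) ^+ 2).
Definition height z : R := dst z p / (dst z p + dst z q).
(** Cosine and sine of the argument of (z - p) times the conjugate of z - q. *)
Definition ucos z : R :=
  ((z.1 - p.1) * (z.1 - q.1) + (z.2 - p.2) * (z.2 - q.2)) / (dst z p * dst z q).
Definition usin z : R :=
  ((z.2 - p.2) * (z.1 - q.1) - (z.1 - p.1) * (z.2 - q.2)) / (dst z p * dst z q).

Lemma dst_ge0 z w : 0 <= dst z w. Proof. exact: sqrtr_ge0. Qed.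

Lemma dst_sqr z w : dst z w ^+ 2 = (z.1 - w.1) ^+ 2 + (z.2 - w.2) ^+ 2.
Proof. by rewrite sqr_sqrtr // addr_ge0 // sqr_ge0. Qed.

Lemma dst_eq0 z w : (dst z w == 0) = (z == w).
Proof.
rewrite -sqrf_eq0 dst_sqr paddr_eq0 ?sqr_ge0 // !sqrf_eq0 !subr_eq0.
by case: z w => a b [c d].
Qed.

Lemma dst_gt0 z w : (0 < dst z w) = (z != w).
Proof. by rewrite lt_neqAle dst_ge0 andbT eq_sym dst_eq0. Qed.

Lemma dsum_gt0 z : 0 < dst z p + dst z q.
Proof.
have [->|zp] := eqVneq z p; first by rewrite ltr_wpDl ?dst_ge0 // dst_gt0.
by rewrite ltr_pwDl ?dst_ge0 // dst_gt0.
Qed.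

Lemma height_gt0 z : (0 < height z) = (z != p).
Proof. by rewrite /height pmulr_lgt0 ?invr_gt0 ?dsum_gt0 // dst_gt0. Qed.

Lemma height_p : height p = 0.
Proof. by rewrite /height; have /eqP -> : dst p p == 0; rewrite ?dst_eq0 ?mul0r. Qed.

Lemma height_q : height q = 1.
Proof.
rewrite /height; have /eqP -> : dst q q == 0 by rewrite dst_eq0.
by rewrite addr0 divff // gt_eqF // dst_gt0 eq_sym.
Qed.

Lemma height_lt1 z : (height z < 1) = (z != q).
Proof. by rewrite ltr_pdivrMr ?dsum_gt0 // mul1r ltrDl dst_gt0. Qed.

Lemma unit_dir z : z != p -> z != q -> ucos z ^+ 2 + usin z ^+ 2 = 1.
Proof.
move=> zp zq; rewrite !exprMn !exprVn exprMn !dst_sqr -mulrDl.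
have h1 : (z.1 - p.1) ^+ 2 + (z.2 - p.2) ^+ 2 != 0 by rewrite -dst_sqr sqrf_eq0 dst_eq0.
have h2 : (z.1 - q.1) ^+ 2 + (z.2 - q.2) ^+ 2 != 0 by rewrite -dst_sqr sqrf_eq0 dst_eq0.
by field; rewrite h1 h2.
Qed.

Lemma polar_dst z w r th : 0 < r -> z.1 - w.1 = r * cos th -> z.2 - w.2 = r * sin th -> dst z w = r.
Proof.
move=> r0 h1 h2; rewrite /dst h1 h2 !exprMn -mulrDr cos2Dsin2 mulr1 sqrtr_sqr.
exact: gtr0_norm.
Qed.

(** The direction at z is the difference of its polar angles around p and q. *)
Lemma dir_polar z r r' th th' : 0 < r -> 0 < r' ->
  z.1 - p.1 = r * cos th -> z.2 - p.2 = r * sin th ->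
  z.1 - q.1 = r' * cos th' -> z.2 - q.2 = r' * sin th' ->
  cos (th - th') = ucos z /\ sin (th - th') = usin z.
Proof.
move=> r0 r0' h1 h2 h3 h4; rewrite cosB sinB /ucos /usin.
rewrite (polar_dst r0 h1 h2) (polar_dst r0' h3 h4) h1 h2 h3 h4.
have ne : r != 0 by rewrite gt_eqF.
have ne' : r' != 0 by rewrite gt_eqF.
by split; field; rewrite ne ne'.
Qed.

(** Height and direction determine the complex number (z - p) / (z - q), and
    Moebius maps are injective.  In coordinates, k is its modulus, and the
    difference d of the two points satisfies a homogeneous linear system whose
    determinant vanishes only if that quotient is 1, that is, if p = q. *)
Lemma bipolar_inj z w : z != p -> z != q -> w != p -> w != q ->
  height z = height w -> ucos z = ucos w -> usin z = usin w -> z = w.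
Proof.
move=> zp zq wp wq he hc hs.
pose k := dst z p / dst z q.
have bz : dst z q != 0 by rewrite dst_eq0.
have bw : dst w q != 0 by rewrite dst_eq0.
have az : dst z p != 0 by rewrite dst_eq0.
have aw : dst w p != 0 by rewrite dst_eq0.
have kw : k = dst w p / dst w q.
  have n1 : dst z p + dst z q != 0 by rewrite gt_eqF // dsum_gt0.
  have n2 : dst w p + dst w q != 0 by rewrite gt_eqF // dsum_gt0.
  move: he; rewrite /height => /eqP; rewrite eqr_div // => /eqP h.
  by apply/eqP; rewrite eqr_div //; apply/eqP; lra.
have key x : x != p -> x != q -> k = dst x p / dst x q -> ucos x = ucos z -> usin x = usin z ->
    x.1 - p.1 = k * (ucos z * (x.1 - q.1) - usin z * (x.2 - q.2)) /\
    x.2 - p.2 = k * (ucos z * (x.2 - q.2) + usin z * (x.1 - q.1)).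
  move=> xp xq -> <- <-; rewrite /ucos /usin.
  have a0 : dst x p != 0 by rewrite dst_eq0.
  have b0 : dst x q != 0 by rewrite dst_eq0.
  have b2 := dst_sqr x q.
  by split; apply: (@mulIf _ (dst x q ^+ 2)); rewrite ?expf_neq0 // {1}b2; field; rewrite a0 b0.
have [z1 z2] := key z zp zq erefl erefl erefl.
have [w1 w2] := key w wp wq kw (esym hc) (esym hs).
pose c := k * ucos z - 1; pose s := k * usin z.
pose d1 := z.1 - w.1; pose d2 := z.2 - w.2.
have e1 : c * d1 - s * d2 = 0 by rewrite /c /s /d1 /d2; lra.
have e2 : c * d2 + s * d1 = 0 by rewrite /c /s /d1 /d2; lra.
have cs : c ^+ 2 + s ^+ 2 != 0.
  rewrite paddr_eq0 ?sqr_ge0 // !sqrf_eq0; apply/negP => /andP[/eqP c0 /eqP s0].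
  have kc : k * ucos z = 1 by move: c0; rewrite /c; lra.
  have h1 : z.1 - p.1 = (k * ucos z) * (z.1 - q.1) - (k * usin z) * (z.2 - q.2).
    by rewrite z1; ring.
  have h2 : z.2 - p.2 = (k * ucos z) * (z.2 - q.2) + (k * usin z) * (z.1 - q.1).
    by rewrite z2; ring.
  move/eqP: pq; apply; rewrite [p]surjective_pairing [q]surjective_pairing.
  by move: h1 h2; rewrite kc -/s s0 => h1 h2; congr pair; lra.
have d10 : d1 = 0.
  apply: (mulfI cs); rewrite mulr0.
  have -> : (c ^+ 2 + s ^+ 2) * d1 = c * (c * d1 - s * d2) + s * (c * d2 + s * d1) by ring.
  by rewrite e1 e2 !mulr0 addr0.
have d20 : d2 = 0.
  apply: (mulfI cs); rewrite mulr0.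
  have -> : (c ^+ 2 + s ^+ 2) * d2 = c * (c * d2 + s * d1) - s * (c * d1 - s * d2) by ring.
  by rewrite e1 e2 !mulr0 subr0.
by rewrite [z]surjective_pairing [w]surjective_pairing; congr pair; move: d10 d20; rewrite /d1 /d2; lra.
Qed.

(** Continuity is kept by coordinates, since every function of a curve used below
    is a formula in its two coordinates. *)
Definition curve (z : R -> R * R) : Prop :=
  continuous (fun t => (z t).1) /\ continuous (fun t => (z t).2).

Lemma dst_cont (z : R -> R * R) w : curve z -> continuous (fun t => dst (z t) w).
Proof.
move=> [c1 c2] t; apply: (@continuous_comp _ _ _ (fun t => ((z t).1 - w.1) ^+ 2 + ((z t).2 - w.2) ^+ 2) (@Num.sqrt R)); last exact: sqrt_continuous.
apply: cvgD; apply: cvgM; (apply: cvgB; [first [exact: c1 | exact: c2] | exact: cvg_cst]).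
Qed.

Lemma height_cont (z : R -> R * R) : curve z -> continuous (fun t => height (z t)).
Proof.
move=> cz t; have c1 := @dst_cont z p cz; have c2 := @dst_cont z q cz.
apply: cvgM; first exact: c1.
by apply: cvgV; [rewrite gt_eqF // dsum_gt0 | apply: cvgD; [exact: c1 | exact: c2]].
Qed.

Lemma dstM_cont (z : R -> R * R) (t : R) : curve z -> z t != p -> z t != q ->
  {for t, continuous (fun t => (dst (z t) p * dst (z t) q)^-1)}.
Proof.
move=> cz zp zq; have c1 := @dst_cont z p cz; have c2 := @dst_cont z q cz.
apply: cvgV; first by rewrite mulf_neq0 // dst_eq0.
by apply: cvgM; [exact: c1 | exact: c2].
Qed.

Lemma ucos_cont (z : R -> R * R) (t : R) : curve z -> z t != p -> z t != q -> {for t, continuous (fun t => ucos (z t))}.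
Proof.
move=> cz zp zq; have [c1 c2] := cz; apply: cvgM; last exact: dstM_cont.
apply: cvgD; apply: cvgM; (apply: cvgB; [first [exact: c1 | exact: c2] | exact: cvg_cst]).
Qed.

Lemma usin_cont (z : R -> R * R) (t : R) : curve z -> z t != p -> z t != q -> {for t, continuous (fun t => usin (z t))}.
Proof.
move=> cz zp zq; have [c1 c2] := cz; apply: cvgM; last exact: dstM_cont.
apply: cvgB; apply: cvgM; (apply: cvgB; [first [exact: c1 | exact: c2] | exact: cvg_cst]).
Qed.

Definition far_by (d : R) z w : Prop :=
  [\/ d <= `|height z - height w|, d <= `|ucos z - ucos w| | d <= `|usin z - usin w|].

(** The sum of the three differences of coordinates is continuous and positive on
    a compact rectangle of parameters. *)
Lemma separation (z w : R -> R * R) (a b : R) : 0 <= a -> 0 <= b -> curve z -> curve w ->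
  (forall t, 0 <= t <= a -> z t != p /\ z t != q) ->
  (forall t, 0 <= t <= b -> w t != p /\ w t != q) ->
  (forall s t, 0 <= s <= a -> 0 <= t <= b -> z s != w t) ->
  exists2 d, 0 < d & forall s t, 0 <= s <= a -> 0 <= t <= b -> far_by d (z s) (w t).
Proof.
move=> a0 b0 cz cw hz hw zw.
pose F (u : R * R) : R := `|height (z u.1) - height (w u.2)| + `|ucos (z u.1) - ucos (w u.2)| +
  `|usin (z u.1) - usin (w u.2)|.
pose A : set (R * R) := `[0, a] `*` `[0, b].
have cA : compact A by apply: compact_setX; exact: segment_compact.
have A0 : A !=set0 by exists (0, 0); split; rewrite /= in_itv /= lexx.
have c1 (f : R -> R) (u : R * R) : {for u.1, continuous f} -> {for u, continuous (fun v : R * R => f v.1)}.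
  by move=> cf; apply: cvg_comp; [exact: cvg_fst | exact: cf].
have c2 (f : R -> R) (u : R * R) : {for u.2, continuous f} -> {for u, continuous (fun v : R * R => f v.2)}.
  by move=> cf; apply: cvg_comp; [exact: cvg_snd | exact: cf].
have cF : {within A, continuous F}.
  apply: continuous_in_subspaceT => u; rewrite inE => -[/=]; rewrite !in_itv /= => /hz[zp zq] /hw[wp wq].
  have cn (f g : R -> R) : {for u.1, continuous f} -> {for u.2, continuous g} ->
      {for u, continuous (fun v : R * R => `|f v.1 - g v.2|)}.
    by move=> cf cg; apply: cvg_norm; apply: cvgB; [exact: (c1 f) | exact: (c2 g)].
  apply: cvgD; first apply: cvgD.
  - by apply: (cn (fun t => height (z t)) (fun t => height (w t))); exact: height_cont.
  - by apply: (cn (fun t => ucos (z t)) (fun t => ucos (w t))); exact: ucos_cont.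
  - by apply: (cn (fun t => usin (z t)) (fun t => usin (w t))); exact: usin_cont.
have [m mA hm] := compact_EVT_min A0 cA cF.
have Fm : 0 < F m.
  move: mA; rewrite inE => -[/=]; rewrite !in_itv /= => ma mb.
  have [zp zq] := hz _ ma; have [wp wq] := hw _ mb.
  rewrite lt_neqAle /F !addr_ge0 // andbT eq_sym !paddr_eq0 ?addr_ge0 // !normr_eq0 !subr_eq0.
  apply/negP => /andP[/andP[/eqP e1 /eqP e2] /eqP e3].
  by have := zw _ _ ma mb; rewrite (bipolar_inj zp zq wp wq e1 e2 e3) eqxx.
exists (F m / 3); first by rewrite divr_gt0.
move=> s t hs ht; have : F m <= F (s, t).
  by apply: hm; rewrite inE; split; rewrite /= in_itv.
rewrite /far_by {2}/F /= => h.
have [h1|h1] := leP (F m / 3) `|height (z s) - height (w t)|; first exact: Or31.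
have [h2|h2] := leP (F m / 3) `|ucos (z s) - ucos (w t)|; first exact: Or32.
by apply: Or33; lra.
Qed.
End Bipolar.

(** * From curves to lattice walks *)

Section Track.
Variable R : realType.

(** Grid with K columns per turn and L rows. *)
Definition rnd (K L : nat) (e th : R) : pt :=
  cell (Num.floor (th * K%:R / (2 * pi))) (Num.floor (e * L%:R)).

Definition close (u v : pt) : bool := (`|u.1 - v.1| <= 1) && (`|u.2 - v.2| <= 1).

Lemma floor_close (x y : R) : `|x - y| < 1 -> `|Num.floor x - Num.floor y| <= 1.
Proof.
move=> h; have /andP[h1 h2] := floor_itv x; have /andP[h3 h4] := floor_itv y.
move: h; rewrite ltr_norml => /andP[h5 h6].
have : (Num.floor x < Num.floor y + 2) /\ (Num.floor y < Num.floor x + 2).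
  by split; rewrite -(ltr_int R) intrD; move: h2 h4; rewrite !intrD; lra.
lia.
Qed.

Lemma walk_trans x y z P Q : walk x y P -> walk y z Q ->
  exists2 S, walk x z S & forall u, u \in S -> u \in P ++ Q.
Proof.
move=> wP wQ.
have [P' eP] : exists P', P = rcons P' y.
  case/and4P: wP => + _ + _; case/lastP: P => // s w _.
  by rewrite last_rcons => /eqP ->; exists s.
have [Q' eQ] : exists Q', Q = y :: Q'.
  by case/and4P: wQ => + + _ _; case: Q => // w s _ /= /eqP ->; exists s.
exists (P' ++ y :: Q'); first by apply: walk_cat; [rewrite -eP | rewrite -eQ].
by move=> u; rewrite eP -cat_rcons !mem_cat eQ in_cons => /orP[->//|->]; rewrite !orbT.
Qed.

Lemma close_walk u v : close u v -> exists2 P, walk u v P & forall w, w \in P -> close w v.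
Proof.
case: u v => a b [c d]; rewrite /close /= => h.
have w1 (x y : pt) : adj x y -> walk x y [:: x; y] by move=> xy; rewrite /walk /= !eqxx xy.
have [e1|e1] := eqVneq a c; have [e2|e2] := eqVneq b d.
- exists [:: cell c d]; first by rewrite e1 e2 /walk /= !eqxx.
  by move=> w; rewrite inE => /eqP -> /=; rewrite !subrr.
- exists [:: cell a b; cell c d]; first by apply: w1; rewrite /adj /=; lia.
  by move=> w; rewrite !inE => /orP[]/eqP -> /=; lia.
- exists [:: cell a b; cell c d]; first by apply: w1; rewrite /adj /=; lia.
  by move=> w; rewrite !inE => /orP[]/eqP -> /=; lia.
- exists [:: cell a b; cell c b; cell c d].
    have a1 : adj (cell a b) (cell c b) by rewrite /adj /=; lia.
    have a2 : adj (cell c b) (cell c d) by rewrite /adj /=; lia.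
    by rewrite /walk /= !eqxx a1 a2.
  by move=> w; rewrite !inE => /or3P[]/eqP -> /=; lia.
Qed.

(** The relation Lf t th says that th is an admissible angle at time t.  If
    admissible angles and the height vary little in short time, the rounded points
    move by at most one unit in each direction, and [real_induction] chains such
    moves. *)
Lemma track (K L : nat) (e : R -> R) (Lf : R -> R -> Prop) (a b tha : R) :
  (0 < K)%N -> (0 < L)%N -> a <= b -> Lf a tha ->
  (forall s, a <= s <= b -> forall eps, 0 < eps -> exists2 d, 0 < d &
     forall t t', a <= t <= b -> a <= t' <= b -> `|t - s| < d -> `|t' - s| < d ->
     `|e t - e t'| < eps /\
     forall th, Lf t th -> exists2 th', Lf t' th' & `|th' - th| < eps) ->
  exists thb C, [/\ Lf b thb, walk (rnd K L (e a) tha) (rnd K L (e b) thb) C &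
    forall u, u \in C -> exists s th, [/\ a <= s <= b, Lf s th & close u (rnd K L (e s) th)]].
Proof.
move=> K0 L0 ab La loc.
have refl_close u : close u u by rewrite /close !subrr.
pose Q c := exists thb C, [/\ Lf c thb, walk (rnd K L (e a) tha) (rnd K L (e c) thb) C &
    forall u, u \in C -> exists s th, [/\ a <= s <= b, Lf s th & close u (rnd K L (e s) th)]].
apply: (@real_induction R Q a b ab).
  exists tha, [:: rnd K L (e a) tha]; split => //; first by rewrite /walk /= !eqxx.
  by move=> u; rewrite inE => /eqP ->; exists a, tha; rewrite lexx.
move=> s sab; have pi0 := pi_gt0 R.
have K0' : 0 < K%:R :> R by rewrite ltr0n.
have L0' : 0 < L%:R :> R by rewrite ltr0n.
have eps0 : 0 < Num.min (L%:R^-1) (2 * pi / K%:R) :> R.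
  by rewrite lt_min invr_gt0 L0' divr_gt0 ?mulr_gt0.
have [d d0 hd] := loc s sab _ eps0; exists d => // t t' tab t'ab ts t's.
move=> [th [C [Lt wC hC]]].
have [+ /(_ th Lt)[th' Lt']] := hd t t' tab t'ab ts t's; rewrite !lt_min => /andP[he _] /andP[_ hth].
have cl : close (rnd K L (e t) th) (rnd K L (e t') th').
  apply/andP; split; apply: floor_close.
    have -> : th * K%:R / (2 * pi) - th' * K%:R / (2 * pi) = (th - th') * (K%:R / (2 * pi)) by ring.
    rewrite normrM [`|K%:R / _|]gtr0_norm ?divr_gt0 ?mulr_gt0 // -ltr_pdivlMr ?divr_gt0 ?mulr_gt0 //.
    by rewrite invf_div mul1r distrC.
  by rewrite -mulrBl normrM (gtr0_norm L0') -ltr_pdivlMr // div1r.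
have [P wP hP] := close_walk cl; have [S wS hS] := walk_trans wC wP.
exists th', S; split => // u /hS; rewrite mem_cat => /orP[/hC//|/hP h].
by exists t', th'.
Qed.

Variables (p q : R * R).

(** Each vertex of C is next to the lattice point of some point of E, for some lift
    of the direction of that point. *)
Definition traces (K L : nat) (E : set (R * R)) (C : seq pt) : Prop :=
  forall u, u \in C -> exists z th, [/\ E z, cos th = ucos p q z, sin th = usin p q z &
    close u (rnd K L (height p q z) th)].

Lemma traces_rows (K L : nat) E C (lo hi : R) : traces K L E C ->
  (forall z, E z -> lo <= height p q z <= hi) ->
  forall u, u \in C -> Num.floor (lo * L%:R) - 1 <= u.2 <= Num.floor (hi * L%:R) + 1.
Proof.
move=> tr hE u /tr[z [th [/hE/andP[h1 h2] _ _ /andP[_ hu]]]].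
have f1 : Num.floor (lo * L%:R) <= Num.floor (height p q z * L%:R) by apply: le_floor; rewrite ler_wpM2r.
have f2 : Num.floor (height p q z * L%:R) <= Num.floor (hi * L%:R) by apply: le_floor; rewrite ler_wpM2r.
by move: hu f1 f2; rewrite /rnd /=; lia.
Qed.

Lemma floor_far (x y : R) (k : int) : `|Num.floor x + k - Num.floor y| <= 2 -> `|x + k%:~R - y| < 3.
Proof.
move=> h; have /andP[h1 h2] := floor_itv x; have /andP[h3 h4] := floor_itv y.
have [g1 g2] : Num.floor x + k - Num.floor y <= 2 /\ Num.floor y - (Num.floor x + k) <= 2 by lia.
move: g1 g2; rewrite -!(ler_int R) !intrD !mulrNz !intrD; move: h2 h4; rewrite !intrD => h2 h4 g1 g2.
by rewrite ltr_norml; lra.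
Qed.

(** If two such vertices coincided modulo the period, then the points behind them
    would differ by less than 3 grid units in each lifted coordinate, and cosine
    and sine do not expand distances. *)
Lemma traces_apart (K L : nat) (E E' : set (R * R)) C C' (d : R) : (0 < K)%N -> (0 < L)%N ->
  3 * (2 * pi) / K%:R <= d -> 3 / L%:R <= d ->
  traces K L E C -> traces K L E' C' ->
  (forall z w, E z -> E' w -> far_by p q d z w) ->
  apart K%:Z C C'.
Proof.
move=> K0 L0 dK dL tC tC' hE k u /tC[z [th [Ez cz sz /andP[u1 u2]]]]; apply/negP => /tC'[w [th' [Ew cw sw /andP[v1 v2]]]].
have pi0 := pi_gt0 R.
have K0' : 0 < K%:R :> R by rewrite ltr0n.
have L0' : 0 < L%:R :> R by rewrite ltr0n.
have r1 : `|th + 2 * pi * k%:~R - th'| < d.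
  have : `|th * K%:R / (2 * pi) + (k * K%:Z)%:~R - th' * K%:R / (2 * pi)| < 3.
    by apply: floor_far; move: u1 v1; rewrite /rnd /sh /=; lia.
  have -> : th * K%:R / (2 * pi) + (k * K%:Z)%:~R - th' * K%:R / (2 * pi) =
     (th + 2 * pi * k%:~R - th') * (K%:R / (2 * pi)).
    by rewrite intrM -[K%:Z%:~R]/(K%:R : R); move: (pi_gt0 R); move: (@pi R) => P P0; field; rewrite gt_eqF.
  rewrite normrM [`|K%:R / _|]gtr0_norm ?divr_gt0 ?mulr_gt0 // -ltr_pdivlMr ?divr_gt0 ?mulr_gt0 //.
  by rewrite invf_div mulrA => /lt_le_trans; apply.
have r2 : `|height p q z - height p q w| < d.
  have : `|height p q z * L%:R + 0%:~R - height p q w * L%:R| < 3.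
    by apply: floor_far; move: u2 v2; rewrite /rnd /sh /=; lia.
  rewrite addr0 -mulrBl normrM (gtr0_norm L0') -ltr_pdivlMr // => /lt_le_trans; exact.
have [c1 s1] := cos_sin_shift th k.
case: (hE z w Ez Ew) => h.
- by move: r2; rewrite ltNge h.
- have := cos_lip (th + 2 * pi * k%:~R) th'; rewrite c1 cz cw => /(le_trans h).
  by rewrite leNgt r1.
- have := sin_lip (th + 2 * pi * k%:~R) th'; rewrite s1 sz sw => /(le_trans h).
  by rewrite leNgt r1.
Qed.

Lemma rnd_shift (K L : nat) (e th : R) (m : int) : (0 < K)%N ->
  rnd K L e (th + 2 * pi * m%:~R) = sh (m * K%:Z) (rnd K L e th).
Proof.
move=> K0; have pi0 := pi_gt0 R; rewrite /rnd /sh /=; congr pair.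
have -> : m * K%:Z = Num.floor ((m * K%:Z)%:~R : R) by rewrite intrKfloor.
rewrite -floorDrz ?intr_int //; congr Num.floor.
by rewrite intrM -[K%:Z%:~R]/(K%:R : R); move: (pi_gt0 R); move: (@pi R) => P P0; field; rewrite gt_eqF.
Qed.
Hypothesis pq : p != q.

(** The direction at the points of the curve need not be lifted beforehand: any
    lift at one time has a nearby lift at every close time ([small_angle]). *)
Lemma track_curve (K L : nat) (z : R -> R * R) (a th0 : R) : (0 < K)%N -> (0 < L)%N -> 0 <= a ->
  curve z -> (forall t, 0 <= t <= a -> z t != p /\ z t != q) ->
  cos th0 = ucos p q (z 0) -> sin th0 = usin p q (z 0) ->
  exists th1 C, walk (rnd K L (height p q (z 0)) th0) (rnd K L (height p q (z a)) th1) C /\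
    traces K L (z @` `[0, a]) C.
Proof.
move=> K0 L0 a0 cz hz hc hs.
pose Lf t th := cos th = ucos p q (z t) /\ sin th = usin p q (z t).
have loc s : 0 <= s <= a -> forall eps, 0 < eps -> exists2 d, 0 < d &
     forall t t', 0 <= t <= a -> 0 <= t' <= a -> `|t - s| < d -> `|t' - s| < d ->
     `|height p q (z t) - height p q (z t')| < eps /\
     forall th, Lf t th -> exists2 th', Lf t' th' & `|th' - th| < eps.
  move=> sa eps eps0; have [zp zq] := hz s sa; have eps2 : 0 < eps / 2 by rewrite divr_gt0.
  have [k k0 hk] := small_angle eps0.
  have k2 : 0 < k / 2 by rewrite divr_gt0.
  have [d1 d10 h1] := continuous_eps (@height_cont _ _ _ pq z cz s) eps2.
  have [d2 d20 h2] := continuous_eps (ucos_cont cz zp zq) k2.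
  have [d3 d30 h3] := continuous_eps (usin_cont cz zp zq) k2.
  exists (Num.min d1 (Num.min d2 d3)); first by rewrite !lt_min d10 d20.
  move=> t t' ta t'a; rewrite !lt_min => /and3P[t1 t2 t3] /and3P[t1' t2' t3'].
  split.
    by have := h1 _ t1; have := h1 _ t1'; rewrite !ltr_norml; lra.
  move=> th [tc ts]; have [tp tq] := hz t ta; have [tp' tq'] := hz t' t'a.
  have g2 : `|ucos p q (z t') - ucos p q (z t)| < k.
    by have := h2 _ t2; have := h2 _ t2'; rewrite !ltr_norml; lra.
  have g3 : `|usin p q (z t') - usin p q (z t)| < k.
    by have := h3 _ t3; have := h3 _ t3'; rewrite !ltr_norml; lra.
  have [th' [e1 e2 e3]] := hk _ _ _ _ (unit_dir tp tq) (unit_dir tp' tq') g2 g3 th tc ts.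
  by exists th'.
have [th1 [C [_ wC tC]]] := track K0 L0 a0 (conj hc hs : Lf 0 th0) loc.
exists th1, C; split => // u /tC[s [th [sa [e1 e2] cl]]].
by exists (z s), th; split => //; exists s => //; rewrite /= in_itv.
Qed.

Lemma track_lift (K L : nat) (z : R -> R * R) (th : R -> R) (a : R) : (0 < K)%N -> (0 < L)%N -> 0 <= a ->
  curve z -> continuous th ->
  (forall t, 0 <= t <= a -> cos (th t) = ucos p q (z t) /\ sin (th t) = usin p q (z t)) ->
  exists C, walk (rnd K L (height p q (z 0)) (th 0)) (rnd K L (height p q (z a)) (th a)) C /\
    traces K L (z @` `[0, a]) C.
Proof.
move=> K0 L0 a0 cz cth hth.
pose Lf t x := x = th t.
have loc s : 0 <= s <= a -> forall eps, 0 < eps -> exists2 d, 0 < d &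
     forall t t', 0 <= t <= a -> 0 <= t' <= a -> `|t - s| < d -> `|t' - s| < d ->
     `|height p q (z t) - height p q (z t')| < eps /\
     forall x, Lf t x -> exists2 x', Lf t' x' & `|x' - x| < eps.
  move=> sa eps eps0; have eps2 : 0 < eps / 2 by rewrite divr_gt0.
  have [d1 d10 h1] := continuous_eps (@height_cont _ _ _ pq z cz s) eps2.
  have [d2 d20 h2] := continuous_eps (cth s) eps2.
  exists (Num.min d1 d2); first by rewrite !lt_min d10 d20.
  move=> t t' ta t'a; rewrite !lt_min => /andP[t1 t2] /andP[t1' t2'].
  split.
    by have := h1 _ t1; have := h1 _ t1'; rewrite !ltr_norml; lra.
  move=> x ->; exists (th t') => //.
  by have := h2 _ t2; have := h2 _ t2'; rewrite !ltr_norml; lra.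
have [th1 [C [e1 wC tC]]] := track K0 L0 a0 (erefl : Lf 0 (th 0)) loc.
rewrite e1 in wC.
exists C; split => // u /tC[s [x [sa -> cl]]].
have [h1 h2] := hth s sa.
by exists (z s), (th s); split => //; exists s => //; rewrite /= in_itv.
Qed.
End Track.

(** Descend vertically from y to row 0. *)
Lemma low_of_walk (H : int) x y M : walk x y M -> {in M, forall u : pt, 0 < u.2 < H} ->
  exists A, low H x A /\ forall u, u \in A -> u \in M \/ u.2 < y.2.
Proof.
have [n hn] : exists n : nat, (y.2 < n%:Z)%R by exists (`|(y.2 + 1)%R|%N); lia.
elim: n y M hn => [|n IH] y M hn wM hM.
  by have := hM y (proj2 (andP (walk_mem wM))); lia.
have yM := hM y (proj2 (andP (walk_mem wM))).
pose y' := cell y.1 (y.2 - 1).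
have [S wS hS] : exists2 S, walk x y' S & S = rcons M y'.
  exists (rcons M y') => //.
  have [M' eM] : exists M', M = rcons M' y.
    case/and4P: wM => + _ + _; case/lastP: M {hM} => // s w _.
    by rewrite last_rcons => /eqP ->; exists s.
  rewrite eM -cats1 cat_rcons; apply: walk_cat; first by rewrite -eM.
  rewrite /walk /= !eqxx andbT; rewrite /adj /y' /=; lia.
have [y1|y1] := eqVneq y.2 1.
  exists (rev S); split; last first.
    move=> u; rewrite mem_rev hS mem_rcons inE => /orP[/eqP->|]; last by left.
    by right; rewrite /y' /=; lia.
  exists y'; split; first by rewrite -walk_rev.
  - by rewrite /y' /= y1.
  - by have := hM x (proj1 (andP (walk_mem wM))); lia.
  - by rewrite hS rev_rcons /= => u; rewrite mem_rev => /hM.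
have [||A [lA hA]] := IH y' S _ wS; first by rewrite /y' /=; lia.
  move=> u; rewrite hS mem_rcons inE => /orP[/eqP->|/hM//]; rewrite /y' /=; lia.
exists A; split => // u /hA; rewrite hS mem_rcons inE /y' /= => -[/orP[/eqP->|]|]; last by right; lia.
- by right => /=; lia.
- by left.
Qed.

Lemma high_of_walk (H : int) x y M : walk x y M -> {in M, forall u : pt, 0 < u.2 < H} ->
  exists B, high H x B /\ forall u, u \in B -> u \in M \/ y.2 < u.2.
Proof.
have [n hn] : exists n : nat, (H - y.2 < n%:Z)%R by exists (`|(H - y.2 + 1)%R|%N); lia.
elim: n y M hn => [|n IH] y M hn wM hM.
  by have := hM y (proj2 (andP (walk_mem wM))); lia.
have yM := hM y (proj2 (andP (walk_mem wM))).
pose y' := cell y.1 (y.2 + 1).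
have [S wS hS] : exists2 S, walk x y' S & S = rcons M y'.
  exists (rcons M y') => //.
  have [M' eM] : exists M', M = rcons M' y.
    case/and4P: wM => + _ + _; case/lastP: M {hM} => // s w _.
    by rewrite last_rcons => /eqP ->; exists s.
  rewrite eM -cats1 cat_rcons; apply: walk_cat; first by rewrite -eM.
  rewrite /walk /= !eqxx andbT; rewrite /adj /y' /=; lia.
have [y1|y1] := eqVneq (y.2 + 1) H.
  exists S; split; last first.
    move=> u; rewrite hS mem_rcons inE => /orP[/eqP->|]; last by left.
    by right; rewrite /y' /=; lia.
  exists y'; split => //.
  - by have := hM x (proj1 (andP (walk_mem wM))); lia.
  - by rewrite hS rev_rcons /= => u; rewrite mem_rev => /hM.
have [||B [hB mB]] := IH y' S _ wS; first by rewrite /y' /=; lia.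
  move=> u; rewrite hS mem_rcons inE => /orP[/eqP->|/hM//]; rewrite /y' /=; lia.
exists B; split => // u /mB; rewrite hS mem_rcons inE /y' /= => -[/orP[/eqP->|]|]; last by right; lia.
- by right => /=; lia.
- by left.
Qed.

Lemma min_pos (R : realType) (I : finType) (P : I -> R -> Prop) :
  (forall i, exists2 d, 0 < d & forall d', 0 < d' <= d -> P i d') ->
  exists2 d, 0 < d & forall i, P i d.
Proof.
move=> h; suff [d d0 hd] : exists2 d, 0 < d & forall i, i \in enum I -> forall d', 0 < d' <= d -> P i d'.
  by exists d => // i; apply: (hd i); rewrite ?mem_enum // d0 lexx.
elim: (enum I) => [|i s [d d0 hd]]; first by exists 1.
have [d1 d10 h1] := h i; exists (Num.min d d1); first by rewrite lt_min d0.
move=> j; rewrite inE => /orP[/eqP->|js] d'; rewrite le_min => /and3P[d'0 d'1 d'2].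
  by apply: h1; rewrite d'0.
by apply: hd; rewrite ?d'0.
Qed.

Lemma pos_bound (R : realType) (f : R -> R) : continuous f -> (forall t, 0 <= t <= 1 -> 0 < f t) ->
  exists2 m, 0 < m & forall t, 0 <= t <= 1 -> m <= f t.
Proof.
move=> cf hf; have [c c01 hc] := @EVT_min R f 0 1 ler01 (continuous_subspaceT cf).
by exists (f c); [apply: hf; rewrite in_itv in c01 | move=> t ht; apply: hc; rewrite in_itv].
Qed.

(** If no such time existed, r < f would propagate from 0 to 1. *)
Lemma first_time (R : realType) (f : R -> R) (r : R) : continuous f -> r < f 0 -> f 1 <= r ->
  exists2 a, 0 <= a <= 1 & f a = r /\ forall t, 0 <= t <= a -> r <= f t.
Proof.
move=> cf f0 f1; apply: contrapT => no.
pose Q t := forall s, 0 <= s <= t -> r < f s.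
suff : Q 1 by move=> /(_ 1); rewrite ler01 lexx => /(_ isT); rewrite ltNge f1.
apply: (@real_induction R Q 0 1 ler01).
  by move=> s s0; have -> : s = 0 by lra.
move=> s s01; have [fs|fs] := ltP r (f s).
  have e0 : 0 < f s - r by lra.
  have [d d0 hd] := continuous_eps (cf s) e0; exists d => // t t' _ _ ts t's Qt u /andP[u0 ut'].
  have [ut|ut] := leP u t; first by apply: Qt; rewrite u0.
  move: ts t's; rewrite !ltr_norml => ts t's.
  have us : `|u - s| < d by rewrite ltr_norml; lra.
  by have := hd u us; rewrite ltr_norml; lra.
have [[e [e0 he]]|ne] := pselect (exists e, 0 < e /\ forall t, 0 <= t <= 1 -> `|t - s| < e -> ~ Q t).
  by exists e => // t t' t01 _ ts _ /(he t t01 ts).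
exfalso; apply: no.
have below u : 0 <= u < s -> r < f u.
  move=> u0; apply: contrapT => nu; apply: ne; exists (s - u); split; first by lra.
  move=> t t01 ts Qt; apply: nu; apply: Qt; rewrite ltr_norml in ts; lra.
have s0 : 0 < s.
  by rewrite lt_neqAle; apply/andP; split; [apply/eqP => e; move: fs; rewrite -e; lra | lra].
have fsr : f s = r.
  apply/eqP; rewrite eq_le fs /= leNgt; apply/negP => fr.
  have e0 : 0 < r - f s by lra.
  have [d d0 hd] := continuous_eps (cf s) e0.
  pose u := Num.max 0 (s - d / 2).
  have [u1 u2] : 0 <= u < s /\ s - d / 2 <= u.
    by rewrite /u le_max lexx /= gt_max s0 /= le_max lexx orbT; split=> //; lra.
  have us : `|u - s| < d by rewrite ltr_norml; lra.
  by have := below u u1; have := hd u us; rewrite ltr_norml; lra.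
exists s => //; split => // t /andP[t0 ts].
have [tls|->] : t < s \/ t = s by case: ltgtP ts; auto.
  by apply: ltW; apply: below; rewrite t0.
by rewrite fsr.
Qed.

Lemma apart_weaken (K : int) P Q P' Q' :
  (forall u v : pt, u \in P -> v \in Q -> u.2 = v.2 -> u \in P' /\ v \in Q') ->
  apart K P' Q' -> apart K P Q.
Proof.
move=> h ap k u uP; apply/negP => vQ.
by have [u' v'] := h _ _ uP vQ erefl; move: (ap k u u'); rewrite v'.
Qed.

Lemma big_nat (R : realType) (r : R) : exists n : nat, r <= n%:R.
Proof. by exists (Num.truncn r).+1; apply: ltW; exact: truncnS_gt. Qed.

Section Discretize.
Variables (R : realType) (p q : R * R).
Hypothesis pq : p != q.
Variables (al be c : 'I_3 -> R -> R * R) (Th : 'I_3 -> R) (th : 'I_3 -> R -> R).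
Variables (a1 a2 : 'I_3 -> 'I_3) (s : 'I_3 -> int).
Hypothesis cal : forall i, curve (al i).
Hypothesis cbe : forall i, curve (be i).
Hypothesis cc : forall i, curve (c i).
Hypothesis cth : forall i, continuous (th i).
Hypothesis al0 : forall i, al i 0 = be i 0.
Hypothesis al1 : forall i, al i 1 = p.
Hypothesis be1 : forall i, be i 1 = q.
Hypothesis alq : forall (i : 'I_3) (t : R), 0 <= t <= 1 -> al i t != q.
Hypothesis bep : forall (i : 'I_3) (t : R), 0 <= t <= 1 -> be i t != p.
Hypothesis cpq : forall (i : 'I_3) (t : R), 0 <= t <= 1 -> c i t != p /\ c i t != q.
Hypothesis albe : forall (i j : 'I_3) (t t' : R), i != j -> 0 <= t <= 1 -> 0 <= t' <= 1 -> al i t != be j t'.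
Hypothesis cab : forall (i : 'I_3) (t t' : R), 0 <= t <= 1 -> 0 <= t' <= 1 -> c i t != al i t' /\ c i t != be i t'.
Hypothesis hTh : forall i, cos (Th i) = ucos p q (al i 0) /\ sin (Th i) = usin p q (al i 0).
Hypothesis hth : forall (i : 'I_3) (t : R), 0 <= t <= 1 -> cos (th i t) = ucos p q (c i t) /\ sin (th i t) = usin p q (c i t).
Hypothesis c0 : forall i, c i 0 = al (a1 i) 0 /\ th i 0 = Th (a1 i).
Hypothesis c1 : forall i, c i 1 = al (a2 i) 0 /\ th i 1 = Th (a2 i) + 2 * pi * (s i)%:~R.

Let hh := height p q.

Lemma hcont z : curve z -> continuous (fun t => hh (z t)).
Proof. by move=> cz; exact: height_cont. Qed.

Lemma height_margin : exists2 m, 0 < m < 1 / 2 & forall (i : 'I_3) (t : R), 0 <= t <= 1 ->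
  [/\ m <= hh (be i t), hh (al i t) <= 1 - m & m <= hh (c i t) <= 1 - m].
Proof.
have [|m m0 hm] := @min_pos R 'I_3 (fun i m => forall t, 0 <= t <= 1 ->
  [/\ m <= hh (be i t), hh (al i t) <= 1 - m & m <= hh (c i t) <= 1 - m]).
  move=> i.
  have cN z : curve z -> continuous (fun t => 1 - hh (z t)).
    by move=> cz t; apply: cvgB; [exact: cvg_cst | exact: hcont].
  have [|m1 m10 h1] := pos_bound (hcont (cbe i)).
    by move=> t ht; rewrite height_gt0 // bep.
  have [|m2 m20 h2] := pos_bound (cN _ (cal i)).
    by move=> t ht; rewrite subr_gt0 height_lt1 // alq.
  have [|m3 m30 h3] := pos_bound (hcont (cc i)).
    by move=> t ht; rewrite height_gt0 //; case: (cpq i ht).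
  have [|m4 m40 h4] := pos_bound (cN _ (cc i)).
    by move=> t ht; rewrite subr_gt0 height_lt1 //; case: (cpq i ht).
  exists (Num.min (Num.min m1 m2) (Num.min m3 m4)); first by rewrite !lt_min m10 m20 m30.
  move=> d; rewrite !le_min => /andP[d0 /andP[/andP[d1 d2] /andP[d3 d4]]] t ht.
  have := h1 t ht; have := h2 t ht; have := h3 t ht; have := h4 t ht.
  by move=> g4 g3 g2 g1; split; lra.
exists (m / 2); last by move=> i t ht; have [g1 g2 g3] := hm i t ht; split; lra.
by have [_ _] := hm ord0 0 (introT andP (conj (lexx 0) ler01)); lra.
Qed.

(** The arms are cut where their height first reaches rho or 1 - rho, with rho half
    of the margin m, because the direction is undefined at p and q; vertical walks
    replace the remaining pieces.  On a grid with m L >= 8 the rows of these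
    vertical pieces are disjoint from all the rows of the other walks which they
    must avoid, so that only the pieces that trace the curves have to be compared
    by [traces_apart]. *)
Lemma discretize : exists (K H : int) (x : 'I_3 -> pt) (A B : 'I_3 -> seq pt),
  [/\ 0 < K, forall i, low H (x i) (A i), forall i, high H (x i) (B i),
   forall i j, i != j -> apart K (A i) (B j) &
   forall i, link K H x A B i (a1 i) (a2 i) (s i)].
Proof.
have [m m01 hm] := height_margin.
have z01 : 0 <= (0 : R) <= 1 by rewrite lexx ler01.
pose rho := m / 2.
have ta i : exists2 a, 0 <= a <= 1 & hh (al i a) = rho /\ forall t, 0 <= t <= a -> rho <= hh (al i t).
  apply: first_time; first exact: hcont.
    by have [g _ _] := hm i 0 z01; rewrite al0 /rho; lra.
  by rewrite al1 /hh height_p // /rho; lra.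
have tb i : exists2 b, 0 <= b <= 1 & hh (be i b) = 1 - rho /\ forall t, 0 <= t <= b -> hh (be i t) <= 1 - rho.
  have cN : continuous (fun t => 1 - hh (be i t)).
    by move=> t; apply: cvgB; [exact: cvg_cst | exact: hcont].
  have N0 : rho < 1 - hh (be i 0) by have [_ g _] := hm i 0 z01; rewrite -al0 /rho; lra.
  have N1 : 1 - hh (be i 1) <= rho by rewrite be1 /hh height_q // /rho; lra.
  have [b b01 [h1 h2]] := first_time cN N0 N1.
  by exists b => //; split; [lra | move=> t /h2; lra].
pose a i := projT1 (cid2 (ta i)).
have a01 i : 0 <= a i <= 1 by rewrite /a; case: cid2.
have ha i : hh (al i (a i)) = rho by rewrite /a; case: cid2 => ? ? [].
have ha' i t : 0 <= t <= a i -> rho <= hh (al i t) by rewrite /a; case: cid2 => ? ? [? h] /h.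
pose b i := projT1 (cid2 (tb i)).
have b01 i : 0 <= b i <= 1 by rewrite /b; case: cid2.
have hb i : hh (be i (b i)) = 1 - rho by rewrite /b; case: cid2 => ? ? [].
have hb' i t : 0 <= t <= b i -> hh (be i t) <= 1 - rho by rewrite /b; case: cid2 => ? ? [? h] /h.
have a0 i : 0 <= a i by case/andP: (a01 i).
have b0 i : 0 <= b i by case/andP: (b01 i).
have ta1 i t : 0 <= t <= a i -> 0 <= t <= 1 by have := a01 i; lra.
have tb1 i t : 0 <= t <= b i -> 0 <= t <= 1 by have := b01 i; lra.
have alpq i t : 0 <= t <= a i -> al i t != p /\ al i t != q.
  move=> ht; split; last by apply: alq; exact: (ta1 i).
  by rewrite -(height_gt0 pq); have := ha' i t ht; rewrite /hh /rho; lra.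
have bepq i t : 0 <= t <= b i -> be i t != p /\ be i t != q.
  move=> ht; split; first by apply: bep; exact: (tb1 i).
  by rewrite -(height_lt1 pq); have := hb' i t ht; rewrite /hh /rho; lra.
have [d1 d10 hd1] : exists2 d, 0 < d & forall i : 'I_3 * 'I_3, i.1 != i.2 -> forall t t',
    0 <= t <= a i.1 -> 0 <= t' <= b i.2 -> far_by p q d (al i.1 t) (be i.2 t').
  apply: (@min_pos R ('I_3 * 'I_3)%type (fun i d => i.1 != i.2 -> forall t t',
    0 <= t <= a i.1 -> 0 <= t' <= b i.2 -> far_by p q d (al i.1 t) (be i.2 t'))) => -[i j] /=.
  have [<-|ij] := eqVneq i j; first by exists 1.
  have ne t t' : 0 <= t <= a i -> 0 <= t' <= b j -> al i t != be j t'.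
    by move=> /ta1 ht /tb1 ht'; exact: albe.
  have [d d0 hd] := separation pq (a0 i) (b0 j) (cal i) (cbe j) (alpq i) (bepq j) ne.
  exists d => // d' /andP[_ d'd] _ t t' ht ht'.
  by case: (hd t t' ht ht') => h; [apply: Or31 | apply: Or32 | apply: Or33]; exact: le_trans h.
have [d2 d20 hd2] : exists2 d, 0 < d & forall i, forall t t', 0 <= t <= 1 ->
    (0 <= t' <= a i -> far_by p q d (c i t) (al i t')) /\ (0 <= t' <= b i -> far_by p q d (c i t) (be i t')).
  apply: (@min_pos R 'I_3 (fun i d => forall t t', 0 <= t <= 1 ->
    (0 <= t' <= a i -> far_by p q d (c i t) (al i t')) /\ (0 <= t' <= b i -> far_by p q d (c i t) (be i t')))) => i.
  have nea t t' : 0 <= t <= 1 -> 0 <= t' <= a i -> c i t != al i t'.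
    by move=> ht /ta1 ht'; case: (cab i ht ht').
  have neb t t' : 0 <= t <= 1 -> 0 <= t' <= b i -> c i t != be i t'.
    by move=> ht /tb1 ht'; case: (cab i ht ht').
  have [d d0 hd] := separation pq ler01 (a0 i) (cc i) (cal i) (@cpq i) (alpq i) nea.
  have [e e0 he] := separation pq ler01 (b0 i) (cc i) (cbe i) (@cpq i) (bepq i) neb.
  exists (Num.min d e); first by rewrite lt_min d0.
  move=> d' /andP[_]; rewrite le_min => /andP[d'd d'e] t t' ht; split => ht'.
    by case: (hd t t' ht ht') => h; [apply: Or31 | apply: Or32 | apply: Or33]; exact: le_trans h.
  by case: (he t t' ht ht') => h; [apply: Or31 | apply: Or32 | apply: Or33]; exact: le_trans h.
pose d := Num.min d1 d2.
have d0 : 0 < d by rewrite lt_min d10.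
have dd1 : d <= d1 by rewrite /d ge_min lexx.
have dd2 : d <= d2 by rewrite /d ge_min lexx orbT.
have pi0 := pi_gt0 R.
have m0 : 0 < m by case/andP: m01.
have [K hK] := big_nat (3 * (2 * pi) / d).
have [L1 hL1] := big_nat (3 / d).
have [L2 hL2] := big_nat (8 / m).
pose L := (L1 + L2)%N.
have K0 : (0 < K)%N.
  by rewrite -(ltr_nat R); apply: lt_le_trans hK; rewrite divr_gt0 // !mulr_gt0.
have hL : 8 <= m * L%:R.
  by rewrite mulrC -ler_pdivrMr // (le_trans hL2) // ler_nat leq_addl.
have L0 : (0 < L)%N.
  by rewrite lt0n; apply/eqP => l0; move: hL; rewrite l0 mulr0; lra.
have Kd : 3 * (2 * pi) / K%:R <= d by rewrite ler_pdivrMr ?ltr0n // [d * _]mulrC -ler_pdivrMr.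
have Ld : 3 / L%:R <= d.
  by rewrite ler_pdivrMr ?ltr0n // mulrC -ler_pdivrMr // (le_trans hL1) // ler_nat leq_addr.
pose F (e : R) := Num.floor (e * L%:R).
have gap e e' (k : int) : e * L%:R + k%:~R <= e' * L%:R -> F e + k <= F e'.
  by move=> h; rewrite floor_ge_int intrD (le_trans _ h) // lerD2r floor_le.
have rL : rho * L%:R = m * L%:R / 2 by rewrite /rho; lra.
have mL : m * L%:R <= L%:R / 2 by rewrite mulrC ler_wpM2l //; lra.
(* The arms are cut at the rows f0 and f3; the sides stay between f1 and f2. *)
pose f0 := F rho; pose f1 := F m; pose f2 := F (1 - m); pose f3 := F (1 - rho).
have F0 : 4 <= f0 by rewrite floor_ge_int rL; lra.
have F1 : f0 + 4 <= f1 by apply: gap; rewrite rL; lra.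
have F2 : f1 <= f2 by rewrite /f1 -[F m]addr0; apply: gap; rewrite addr0 mulrBl mul1r; lra.
have F3 : f2 + 4 <= f3 by apply: gap; rewrite !mulrBl mul1r rL; lra.
have F4 : f3 + 4 <= L%:Z.
  have -> : L%:Z = F 1 by rewrite /F mul1r (_ : L%:R = L%:Z%:~R) // intrKfloor.
  by apply: gap; rewrite mulrBl !mul1r rL; lra.
pose x i := rnd K L (hh (al i 0)) (Th i).
have tA i : exists AM : seq pt * seq pt, [/\ low L%:Z (x i) AM.1, traces p q K L (al i @` `[0, a i]) AM.2,
    {in AM.2, forall u : pt, f0 - 1 <= u.2 <= f2 + 1} &
    forall u : pt, u \in AM.1 -> u \in AM.2 \/ u.2 < f0].
  have [az _] := andP (a01 i); have [hc hs] := hTh i.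
  have [e [M [wM tM]]] := track_curve pq K0 L0 az (cal i) (alpq i) hc hs.
  have rM : {in M, forall u : pt, f0 - 1 <= u.2 <= f2 + 1}.
    move=> u uM; apply: (traces_rows tM _ uM) => _ [t /= +] <-; rewrite in_itv /= => ht.
    by rewrite ha' //; have [_ g _] := hm i t (ta1 i t ht).
  have [|A [lA hA]] := @low_of_walk L%:Z _ _ M wM.
    by move=> u /rM; clear -F0 F1 F2 F3 F4; lia.
  by exists (A, M); split => // u /hA; rewrite -/hh /= -/hh ha.
have tB i : exists BM : seq pt * seq pt, [/\ high L%:Z (x i) BM.1, traces p q K L (be i @` `[0, b i]) BM.2,
    {in BM.2, forall u : pt, f1 - 1 <= u.2 <= f3 + 1} &
    forall u : pt, u \in BM.1 -> u \in BM.2 \/ f3 < u.2].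
  have [bz _] := andP (b01 i); have [hc hs] := hTh i; rewrite al0 in hc hs.
  have [e [M [wM tM]]] := track_curve pq K0 L0 bz (cbe i) (bepq i) hc hs.
  have rM : {in M, forall u : pt, f1 - 1 <= u.2 <= f3 + 1}.
    move=> u uM; apply: (traces_rows tM _ uM) => _ [t /= +] <-; rewrite in_itv /= => ht.
    by rewrite -/hh hb' // andbT; have [g _ _] := hm i t (tb1 i t ht).
  have [|B [hB mB]] := @high_of_walk L%:Z _ _ M wM.
    by move=> u /rM; clear -F0 F1 F2 F3 F4; lia.
  by exists (B, M); split => //; [rewrite /x al0 | move=> u /mB; rewrite /= -/hh hb].
have tC i : exists C : seq pt, [/\ walk (x (a1 i)) (sh (s i * K%:Z) (x (a2 i))) C,
    traces p q K L (c i @` `[0, 1]) C &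
    {in C, forall u : pt, f1 - 1 <= u.2 <= f2 + 1}].
  have [C [wC tC]] := track_lift pq K0 L0 ler01 (cc i) (@cth i) (hth i).
  exists C; split => //.
    have [e1 e2] := c0 i; have [e3 e4] := c1 i.
    by move: wC; rewrite e1 e2 e3 e4 rnd_shift.
  move=> u uC; apply: (traces_rows tC _ uC) => _ [t /= +] <-; rewrite in_itv /= => ht.
  by have [_ _ g] := hm i t ht.
have [AM hA] := choice tA; have [BM hB] := choice tB.
exists K%:Z, L%:Z, x, (fun i => (AM i).1), (fun i => (BM i).1); split => //.
- by move=> i; case: (hA i).
- by move=> i; case: (hB i).
- move=> i j ij; have [_ tA' rA wA] := hA i; have [_ tB' rB wB] := hB j.
  apply: (@apart_weaken _ _ _ (AM i).2 (BM j).2) => [u v /wA hu /wB hv e|].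
    case: hu hv => [hu|hu] [hv|hv] => //; exfalso.
    - by have := rA u hu; move: hv e; clear -F0 F1 F2 F3 F4; lia.
    - by have := rB v hv; move: hu e; clear -F0 F1 F2 F3 F4; lia.
    - by move: hu hv e; clear -F0 F1 F2 F3 F4; lia.
  apply: (traces_apart K0 L0 (le_trans Kd dd1) (le_trans Ld dd1) tA' tB').
  move=> _ _ [t /= ht <-] [t' /= ht' <-]; rewrite in_itv /= in ht; rewrite in_itv /= in ht'.
  exact: (hd1 (i, j)).
- move=> i; have [C [wC tC' rC]] := tC i; exists C.
  have [_ tA' rA wA] := hA i; have [_ tB' rB wB] := hB i.
  split => //.
  + by move=> u /rC; clear -F0 F1 F2 F3 F4; lia.
  + apply: (@apart_weaken _ _ _ C (AM i).2) => [u v hu /wA hv e|].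
      by case: hv => // hv; exfalso; have := rC u hu; move: hv e; clear -F0 F1 F2 F3 F4; lia.
    apply: (traces_apart K0 L0 (le_trans Kd dd2) (le_trans Ld dd2) tC' tA').
    move=> _ _ [t /= ht <-] [t' /= ht' <-]; rewrite in_itv /= in ht; rewrite in_itv /= in ht'.
    by case: (hd2 i t t' ht) => h _; exact: h.
  + apply: (@apart_weaken _ _ _ C (BM i).2) => [u v hu /wB hv e|].
      by case: hv => // hv; exfalso; have := rC u hu; move: hv e; clear -F0 F1 F2 F3 F4; lia.
    apply: (traces_apart K0 L0 (le_trans Kd dd2) (le_trans Ld dd2) tC' tB').
    move=> _ _ [t /= ht <-] [t' /= ht' <-]; rewrite in_itv /= in ht; rewrite in_itv /= in ht'.
    by case: (hd2 i t t' ht) => _ h; exact: h.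
Qed.
End Discretize.

(** * The triangle in the body of the graph *)

Section Clamp.
Variable R : realType.

(** The retraction of the line onto [0, b].  Composing with it makes curves that are
    given on an interval continuous on the whole line. *)
Definition clamp (b t : R) : R := (`|t| - `|t - b| + b) / 2.

Lemma clamp_cont b : continuous (clamp b).
Proof.
move=> t; apply: cvgM; last exact: cvg_cst.
apply: cvgD; last exact: cvg_cst.
apply: cvgB; apply: cvg_norm; first exact: cvg_id.
by apply: cvgB; [exact: cvg_id | exact: cvg_cst].
Qed.

Lemma clamp_in b t : 0 <= b -> 0 <= clamp b t <= b.
Proof. by rewrite /clamp => b0; case: (ger0P t) => h; case: (ger0P (t - b)) => k; lra. Qed.

Lemma clamp_id b t : 0 <= t <= b -> clamp b t = t.
Proof. by rewrite /clamp => h; rewrite ger0_norm ?ler0_norm; lra. Qed.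

Lemma clamp_left b t : 0 <= b -> t <= 0 -> clamp b t = 0.
Proof. by rewrite /clamp => b0 h; rewrite !ler0_norm; lra. Qed.

Lemma clamp_right b t : 0 <= b -> b <= t -> clamp b t = b.
Proof. by rewrite /clamp => b0 h; rewrite !ger0_norm; lra. Qed.

Lemma within_comp (U V : topologicalType) (A : set U) (f : U -> V) (z : R -> U) :
  {within A, continuous f} -> continuous z -> (forall t, A (z t)) -> continuous (f \o z).
Proof.
move=> /subspace_continuousP cf cz Az t.
apply: (@cvg_comp _ _ _ z f (nbhs t) (within A (nbhs (z t)))); last exact: cf.
move=> B /= /cz; rewrite /= !nbhs_simpl /= => h.
by apply: filterS h => u; apply.
Qed.

(** A lift exists, and its increment is a multiple of 2 pi because the curve is
    closed; so the set from which the winding number is chosen is not empty. *)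
Lemma winding_lift (c z : R -> R * R) (p : R * R) (b : R) : 0 <= b -> curve z ->
  (forall t, 0 <= t <= b -> z t = c t) -> c 0 = c b -> (forall t, 0 <= t <= b -> c t != p) ->
  exists2 th, angle_lift 0 b c p th & th b - th 0 = 2 * pi * (winding_number 0 b c p)%:~R.
Proof.
move=> b0 [cz1 cz2] ze cb cp.
pose x t := (z t).1 - p.1; pose y t := (z t).2 - p.2.
have cx : continuous x by move=> t; apply: cvgB; [exact: cz1 | exact: cvg_cst].
have cy : continuous y by move=> t; apply: cvgB; [exact: cz2 | exact: cvg_cst].
have nz t : 0 <= t <= b -> 0 < x t ^+ 2 + y t ^+ 2.
  move=> tb; rewrite lt_neqAle addr_ge0 ?sqr_ge0 // andbT eq_sym paddr_eq0 ?sqr_ge0 //.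
  rewrite !sqrf_eq0 !subr_eq0; apply/negP => /andP[/eqP e1 /eqP e2].
  have /negP := cp t tb; apply; rewrite -ze //; apply/eqP.
  by rewrite [z t]surjective_pairing e1 e2 -surjective_pairing.
have [th [cth hth]] := lift_exists b0 cx cy nz.
have lift : angle_lift 0 b c p th.
  split; first exact: continuous_subspaceT.
  move=> t; rewrite in_itv /= => tb; have [r r0 [h1 h2]] := hth t tb.
  by exists r; rewrite -ze.
suff [m em] : exists m : int, th b - th 0 = 2 * pi * m%:~R.
  have : [set m : int | exists2 th, angle_lift 0 b c p th & th b - th 0 = 2 * pi * m%:~R] !=set0.
    by exists m, th.
  by rewrite /winding_number => -[w hw]; case: xgetP => [m' _ [th' l' e']|/(_ w)//]; exists th'.
have zb : 0 <= (0 : R) <= b by rewrite lexx.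
have bb : 0 <= b <= b by rewrite lexx andbT.
have [r r0 [h1 h2]] := hth 0 zb; have [r' r0' [h1' h2']] := hth b bb.
have ez : z b = z 0 by rewrite !ze.
rewrite /x /y /= ez in h1' h2'.
have er : r = r' by rewrite -(polar_dst r0 h1 h2) -(polar_dst r0' h1' h2').
have rn : r != 0 by rewrite gt_eqF.
apply: cos_sin_inj; apply: (mulfI rn); first by rewrite {1}er -h1'.
by rewrite {1}er -h2'.
Qed.
End Clamp.

Section Triangle.
Variable R : realType.

Lemma edge_cont i j : continuous (@edge_pt R 5 i j).
Proof.
move=> t; apply: cvgD; apply: cvgZr_tmp; [|exact: cvg_id].
by apply: cvgB; [exact: cvg_cst | exact: cvg_id].
Qed.

Lemma edge_in (i j : 'I_5) (t : R) : edge_body i j (edge_pt i j (clamp 1 t)).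
Proof. by exists (clamp 1 t) => //; rewrite /= in_itv; exact: clamp_in. Qed.

(** The closed walk 1, 2, 3 as one formula on the whole line, so that its continuity
    is that of a sum; each summand moves along one side and then stops. *)
Definition triangle (t : R) : 'rV[R]_5 := vertex_pt R v1 + clamp 1 t *: (vertex_pt R v2 - vertex_pt R v1)
  + clamp 1 (t - 1) *: (vertex_pt R v3 - vertex_pt R v2)
  + clamp 1 (t - 2) *: (vertex_pt R v1 - vertex_pt R v3).

Lemma edge_ptE i j t : @edge_pt R 5 i j t = vertex_pt R i + t *: (vertex_pt R j - vertex_pt R i).
Proof. by rewrite /edge_pt scalerBl scale1r scalerBr addrAC addrA. Qed.

Lemma triangle1 t : t <= 1 -> triangle t = edge_pt v1 v2 (clamp 1 t).
Proof.
move=> h; rewrite /triangle edge_ptE (@clamp_left _ _ (t - 1)) ?(@clamp_left _ _ (t - 2)) //; [|lra..].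
by rewrite !scale0r !addr0.
Qed.

Lemma triangle2 t : 1 <= t <= 2 -> triangle t = edge_pt v2 v3 (clamp 1 (t - 1)).
Proof.
move=> h; rewrite /triangle edge_ptE (@clamp_right _ _ t) ?(@clamp_left _ _ (t - 2)) //; [|lra..].
by rewrite scale0r addr0 scale1r [vertex_pt R v1 + (_ - _)]addrC subrK.
Qed.

Lemma triangle3 t : 2 <= t -> triangle t = edge_pt v3 v1 (clamp 1 (t - 2)).
Proof.
move=> h; rewrite /triangle edge_ptE (@clamp_right _ _ t) ?(@clamp_right _ _ (t - 1)) //; [|lra..].
by rewrite !scale1r [vertex_pt R v1 + (_ - _)]addrC subrK [vertex_pt R v2 + _]addrC subrK.
Qed.

Definition corner_of (i : 'I_3) : 'I_5 := widen_ord (isT : (3 <= 5)%N) i.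

(** The side opposite to the corner i is the one that starts at the corner after
    i, at the time which is the number of that corner. *)
Lemma triangle_leg (i : 'I_3) t : 0 <= t <= 1 ->
  triangle (t + (ordS i)%:R) = edge_pt (corner_of (ordS i)) (corner_of (ordS (ordS i))) (clamp 1 t).
Proof.
move=> ht; have same (j k : 'I_5) : val j = val k -> vertex_pt R j = vertex_pt R k.
  by move=> /val_inj ->.
case: i => [[|[|[|i]]] hi] //.
- rewrite (_ : nat_of_ord (ordS _) = 1%N) // triangle2 ?addrK /edge_pt; last by lra.
  by congr (_ *: _ + _ *: _); apply: same.
- rewrite (_ : nat_of_ord (ordS _) = 2%N) // triangle3 ?addrK /edge_pt; last by lra.
  by congr (_ *: _ + _ *: _); apply: same.
- rewrite (_ : nat_of_ord (ordS _) = 0%N) // addr0 triangle1 /edge_pt; last by lra.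
  by congr (_ *: _ + _ *: _); apply: same.
Qed.

Lemma triangle_cycle t : 0 <= t <= 3 -> triangle t = cycle_pt v1 [:: v2; v3] t.
Proof.
move=> h; rewrite /cycle_pt /=.
case: ifPn => h1; first by rewrite triangle1 // clamp_id //; lra.
rewrite -ltNge in h1.
case: ifPn => h2; first by rewrite triangle2 ?clamp_id //; lra.
rewrite -ltNge in h2.
have -> : t - 1 - 1 = t - 2 by lra.
have -> : t - 2 <= 1 by lra.
by rewrite triangle3 ?clamp_id //; lra.
Qed.

Lemma triangle_cont : continuous triangle.
Proof.
move=> t; apply: cvgD; first apply: cvgD; first apply: cvgD; first exact: cvg_cst.
- by apply: cvgZr_tmp; exact: clamp_cont.
- apply: cvgZr_tmp; apply: cvg_comp; last exact: clamp_cont.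
  by apply: cvgB; [exact: cvg_id | exact: cvg_cst].
- apply: cvgZr_tmp; apply: cvg_comp; last exact: clamp_cont.
  by apply: cvgB; [exact: cvg_id | exact: cvg_cst].
Qed.

Lemma triangle_body t : body K5_minus_45 (triangle t).
Proof.
have [h|h] := lerP t 1; first by right; exists v1, v2; rewrite triangle1 //; split => //; exact: edge_in.
have [h'|h'] := lerP t 2; right.
  by exists v2, v3; rewrite triangle2 ?h' ?ltW //; split => //; exact: edge_in.
by exists v3, v1; rewrite triangle3 ?ltW //; split => //; exact: edge_in.
Qed.

Variable g : 'rV[R]_5 -> R * R.
Hypothesis hg : almost_embedding K5_minus_45 g.

Definition edge_curve (i j : 'I_5) (t : R) : R * R := g (edge_pt i j (clamp 1 t)).

Lemma curve_comp (z : R -> 'rV[R]_5) : continuous z -> (forall t, body K5_minus_45 (z t)) ->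
  curve (g \o z).
Proof.
move=> cz bz; have [cg _] := hg; have cgz := within_comp cg cz bz.
by split=> t; apply: cvg_comp; first [exact: cgz | exact: cvg_fst | exact: cvg_snd].
Qed.

Lemma edge_curve_cont (i j : 'I_5) : K5_minus_45 i j -> curve (edge_curve i j).
Proof.
move=> ij; apply: (@curve_comp (fun t => @edge_pt R 5 i j (clamp 1 t))).
  by move=> t; apply: cvg_comp; [exact: clamp_cont | exact: edge_cont].
by move=> t; right; exists i, j; split => //; exact: edge_in.
Qed.

Lemma edge_curve_disjoint (i j k l : 'I_5) t t' : K5_minus_45 i j -> K5_minus_45 k l -> nonadjacent i j k l ->
  edge_curve i j t != edge_curve k l t'.
Proof.
move=> ij kl no; have [_ /(_ i j k l ij kl no) h] := hg; apply/eqP => e.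
suff : (set0 : set (R * R)) (edge_curve i j t) by [].
rewrite -h; split; [|rewrite e]; [exists (edge_pt i j (clamp 1 t)) | exists (edge_pt k l (clamp 1 t'))] => //; exact: edge_in.
Qed.

Lemma edge_curve0 i j : edge_curve i j 0 = g (vertex_pt R i).
Proof. by rewrite /edge_curve clamp_left // /edge_pt subr0 scale1r scale0r addr0. Qed.

Lemma edge_curve1 i j : edge_curve i j 1 = g (vertex_pt R j).
Proof. by rewrite /edge_curve clamp_right // /edge_pt subrr scale1r scale0r add0r. Qed.

End Triangle.

Theorem theorem1p3 (R : realType) (g : 'rV[R]_5 -> R * R)
    (hg : almost_embedding K5_minus_45 g) :
  let l : int := graph_winding g v1 [:: v2; v3] v4
               - graph_winding g v1 [:: v2; v3] v5 in
  l = 1 \/ l = -1.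
Proof.
move=> l.
pose v := corner_of; pose E := edge_curve g.
pose al i := E (v i) v4; pose be i := E (v i) v5.
pose p := g (vertex_pt R v4); pose q := g (vertex_pt R v5).
pose a1 (i : 'I_3) := ordS i; pose a2 (i : 'I_3) := ordS (ordS i).
pose c i := E (v (a1 i)) (v (a2 i)).
have dis i j k m t t' : K5_minus_45 i j -> K5_minus_45 k m -> nonadjacent i j k m ->
  E i j t != E k m t' by exact: edge_curve_disjoint.
have e4 i : K5_minus_45 (v i) v4 by case: i => [[|[|[|i]]] hi].
have e5 i : K5_minus_45 (v i) v5 by case: i => [[|[|[|i]]] hi].
have e12 i : K5_minus_45 (v (a1 i)) (v (a2 i)) by case: i => [[|[|[|i]]] hi].
have n45 i j : i != j -> nonadjacent (v i) v4 (v j) v5.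
  by case: i j => [[|[|[|i]]] hi] // [[|[|[|j]]] hj].
have nc4 i : nonadjacent (v (a1 i)) (v (a2 i)) (v i) v4 by case: i => [[|[|[|i]]] hi].
have nc5 i : nonadjacent (v (a1 i)) (v (a2 i)) (v i) v5 by case: i => [[|[|[|i]]] hi].
have al1 i : al i 1 = p by exact: edge_curve1.
have be1 i : be i 1 = q by exact: edge_curve1.
have albe i j t t' : i != j -> al i t != be j t' by move=> ij; apply: dis => //; exact: n45.
have cal i t t' : c i t != al i t' by apply: dis.
have cbe i t t' : c i t != be i t' by apply: dis.
have nS (i : 'I_3) : i != ordS i by case: i => [[|[|[|i]]] hi].
(* Hub 4 is on an arm of corner 1 and hub 5 on one of corner 2. *)
have pq : p != q by rewrite -(al1 ord0) -(be1 (ordS ord0)); apply: albe.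
have alq i t : al i t != q by rewrite -(be1 (ordS i)); exact: albe.
have bep i t : be i t != p by rewrite eq_sym -(al1 (ordS i)); apply: albe; rewrite eq_sym.
have cpq i t : c i t != p /\ c i t != q by rewrite -{1}(al1 i) -(be1 i).
pose z := g \o @triangle R.
have cz : curve z by apply: curve_comp => //; [exact: triangle_cont | exact: triangle_body].
have zc i (t : R) : 0 <= t <= 1 -> z (t + (a1 i)%:R) = c i t.
  by move=> ht; rewrite /z /= triangle_leg.
have legs (t : R) : 0 <= t <= 3 -> exists2 u, 0 <= u <= 1 & exists i, t = u + (a1 i)%:R.
  move=> ht; have [h1|h1] := lerP t 1.
    by exists t; [lra | exists ord_max; rewrite (_ : nat_of_ord (a1 _) = 0%N) // addr0].
  have [h2|h2] := lerP t 2.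
    exists (t - 1); first lra.
    by exists ord0; rewrite (_ : nat_of_ord (a1 _) = 1%N) // subrK.
  exists (t - 2); first lra.
  by exists (ordS ord0); rewrite (_ : nat_of_ord (a1 _) = 2%N) // subrK.
have zpq (t : R) : 0 <= t <= 3 -> z t != p /\ z t != q.
  by move=> /legs[u hu [i ->]]; rewrite zc.
have zcyc (t : R) : 0 <= t <= 3 -> z t = (g \o cycle_pt v1 [:: v2; v3]) t.
  by move=> ht; rewrite /z /= triangle_cycle.
have i03 : 0 <= (0 : R) <= 3 by lra.
have i33 : 0 <= (3 : R) <= 3 by lra.
have z03 : z 0 = z 3.
  have [u0 u1] : 0 <= (0 : R) <= 1 /\ 0 <= (1 : R) <= 1 by lra.
  have := zc ord_max 0 u0; have := zc (ordS ord0) 1 u1.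
  rewrite (_ : nat_of_ord (a1 ord_max) = 0%N) // (_ : nat_of_ord (a1 _) = 2%N) // addr0 => e3 ->.
  have -> : (3 : R) = 1 + 2 by lra.
  by rewrite e3 /c /E edge_curve0 edge_curve1; congr (g (vertex_pt R _)); apply: val_inj.
have lift x : (forall t : R, 0 <= t <= 3 -> z t != x) -> exists2 th,
    angle_lift 0 3 (g \o cycle_pt v1 [:: v2; v3]) x th &
    th 3 - th 0 = 2 * pi * (winding_number 0 3 (g \o cycle_pt v1 [:: v2; v3]) x)%:~R.
  move=> zx; apply: (winding_lift _ cz zcyc) => //; first by rewrite -!zcyc.
  by move=> t ht; rewrite -zcyc //; exact: zx.
have [|thp [cp dp] ip] := lift p; first by move=> t /zpq[].
have [|thq [cq dq] iq] := lift q; first by move=> t /zpq[].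
(* By [dir_polar] this is the direction along the triangle. *)
pose th t := thp (clamp 3 t) - thq (clamp 3 t).
have cth : continuous th.
  have c3 := @clamp_cont R 3.
  have in3 t : `[(0 : R), 3]%classic (clamp 3 t) by rewrite /= in_itv /=; exact: clamp_in.
  by move=> t; apply: cvgB; [exact: (within_comp cp c3 in3) | exact: (within_comp cq c3 in3)].
have dir (t : R) : 0 <= t <= 3 -> cos (th t) = ucos p q (z t) /\ sin (th t) = usin p q (z t).
  move=> ht; rewrite /th clamp_id //.
  have [|r [r0 h1 h2]] := dp t; first by rewrite in_itv.
  have [|r' [r0' h1' h2']] := dq t; first by rewrite in_itv.
  by rewrite -zcyc // in h1 h2 h1' h2'; exact: (dir_polar r0 r0' h1 h2 h1' h2').
have turn : th 3 = th 0 + 2 * pi * l%:~R.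
  rewrite /th !clamp_id // /l /graph_winding intrB mulrBr -ip -iq; lra.
pose s (i : 'I_3) : int := if i == ordS ord0 then l else 0.
have bnd (i : 'I_3) (t : R) : 0 <= t <= 1 -> 0 <= t + (a1 i)%:R <= 3.
  move=> ht; have : (a1 i <= 2)%N by rewrite -ltnS.
  by rewrite -(ler_nat R) => h; have := ler0n R (a1 i); lra.
have z0 (i : 'I_3) : z i%:R = al i 0.
  have {2}<- : a1 (a2 i) = i by apply: val_inj; case: i => [[|[|[|i]]] hi].
  have u0 : 0 <= (0 : R) <= 1 by lra.
  have := zc (a2 i) 0 u0; rewrite add0r (_ : nat_of_ord (a1 (a2 i)) = i); last first.
    by case: i => [[|[|[|i]]] hi].
  by move=> ->; rewrite /c /al /E !edge_curve0.
have [K [H [x [A [B [K0 lA hB AB lk]]]]]] : exists (K H : int) (x : 'I_3 -> pt) (A B : 'I_3 -> seq pt),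
  [/\ 0 < K, forall i, low H (x i) (A i), forall i, high H (x i) (B i),
   forall i j, i != j -> apart K (A i) (B j) &
   forall i, link K H x A B i (a1 i) (a2 i) (s i)].
  apply: (@discretize R p q pq al be c (fun i => th i%:R) (fun i t => th (t + (a1 i)%:R)) a1 a2 s) => //.
  - by move=> i; apply: edge_curve_cont.
  - by move=> i; apply: edge_curve_cont.
  - by move=> i; apply: edge_curve_cont.
  - move=> i t; apply: cvg_comp; last exact: cth.
    by apply: cvgD; [exact: cvg_id | exact: cvg_cst].
  - by move=> i; rewrite /al /be /E !edge_curve0.
  - by move=> i j t t' ij _ _; exact: albe.
  - move=> i; rewrite -z0; apply: dir; have := ltn_ord i; rewrite -(ltr_nat R); have := ler0n R i; lra.
  - by move=> i t ht; rewrite -zc //; apply: dir; exact: bnd.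
  - by move=> i; rewrite add0r /c /al /E !edge_curve0.
  - move=> i; rewrite /c /al /E edge_curve0 edge_curve1; split => //.
    have s11 : (1 + 1 = 2 :> R) by lra.
    have s12 : (1 + 2 = 3 :> R) by lra.
    have [[-> -> ->]|[-> -> ->]|[-> -> ->]] : [\/ [/\ a1 i = 1%N :> nat, a2 i = 2%N :> nat & s i = 0],
        [/\ a1 i = 2%N :> nat, a2 i = 0%N :> nat & s i = l] |
        [/\ a1 i = 0%N :> nat, a2 i = 1%N :> nat & s i = 0]].
    + by case: i => [[|[|[|i]]] hi] //; [apply: Or31 | apply: Or32 | apply: Or33].
    + by rewrite mulr0 addr0 s11.
    + by rewrite s12 turn.
    + by rewrite mulr0 !addr0.
have link_at (i j m : 'I_3) : a1 i = j -> a2 i = m -> link K H x A B i j m (s i).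
  by move=> <- <-.
apply: (@strip_theorem _ K H x A B K0 lA hB AB ord0 (ordS ord0) ord_max) => //.
- by apply: (@link_at ord_max); apply: val_inj.
- by apply: (@link_at ord0); apply: val_inj.
- by apply: (@link_at (ordS ord0)); apply: val_inj.
Qed.
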